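(* The decision problem \textsc{Optimal Exchanges}, restricted to instances with $n=2$ agents having identical utilities ($u_1=u_2$), is in P.
   Context: Let $N=\{1,\dots,n\}$ be a set of $n\ge 2$ agents and $M$ a set of $m\ge 1$ indivisible goods. Each agent $i$ has an additive utility function $u_i:2^M\to\mathbb{R}_{\ge 0}$, i.e., $u_i(M')=\sum_{g\in M'}u_i(\{g\})$. An instance consists of $N$, $M$ and $(u_i)_{i\in N}$. An allocation $\mathcal{A}=(A_1,\dots,A_n)$ is an ordered partition of $M$ into $n$ (possibly empty) bundles, $A_i$ going to agent $i$. Agent $i$ is EF1 towards agent $j$ in $\mathcal{A}$ if $A_j=\varnothing$ or there exists $g\in A_j$ with $u_i(A_i)\ge u_i(A_j\setminus\{g\})$. $\mathcal{A}$ is EF1 if every agent is EF1 towards every other agent. An exchange transforms an allocation $\mathcal{A}$ into an allocation $\mathcal{B}$ where, for some distinct $i,j\in N$, $g\in A_i$, $g'\in A_j$, we have $B_i=(A_i\cup\{g'\})\setminus\{g\}$, $B_j=(A_j\cup\{g\})\setminus\{g'\}$, and $B_k=A_k$ for $k\ne i,j$. The optimal number of exchanges required to reach an EF1 allocation from $\mathcal{A}$ is the smallest $T\ge 0$ such that some sequence of $T$ exchanges starting at $\mathcal{A}$ ends in an EF1 allocation ($\infty$ if none exists). \textsc{Optimal Exchanges}: given an instance, an initial allocation $\mathcal{A}$, and a number $k$, decide whether the optimal number of exchanges required to reach an EF1 allocation from $\mathcal{A}$ is at most $k$. In the input, each value $u_i(\{g\})$ is a non-negative integer written in binary. *)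

(* Defs.v *)
From Corelib Require Import BinNums.
From mathcomp Require Import all_boot all_algebra.

Set Implicit Arguments.
Unset Strict Implicit.
Unset Printing Implicit Defensive.

(** * Deterministic multi-tape Turing machines and the class P *)

Inductive direction := Left | Stay | Right.

Section Tape.
Variable G : Type.

(* Two-way infinite tape over [option G], where [None] is the blank symbol.
   The pair [(l, r)] lists the cells to the left of the head, nearest first,
   and the cells from the head (included) to the right; every cell that is not
   listed is blank. *)
Definition tape := (seq (option G) * seq (option G))%type.

Definition tape_read (t : tape) : option G := head None t.2.

Definition tape_write (c : option G) (t : tape) : tape :=
  (t.1, c :: behead t.2).

Definition tape_move (d : direction) (t : tape) : tape :=
  match d with
  | Left => (behead t.1, head None t.1 :: t.2)
  | Stay => t
  | Right => (head None t.2 :: t.1, behead t.2)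
  end.

End Tape.

(* A machine with input alphabet [S], work alphabet [S + tm_extra] and
   [tm_work.+1] tapes, tape [ord0] holding the input.  A state whose verdict is
   [Some true] accepts, one whose verdict is [Some false] rejects, and the
   machine runs on as long as the verdict is [None]. *)
Record machine (S : finType) := Machine {
  tm_extra : finType;
  tm_work : nat;
  tm_state : finType;
  tm_start : tm_state;
  tm_verdict : tm_state -> option bool;
  tm_trans : tm_state -> {ffun 'I_tm_work.+1 -> option (S + tm_extra)} ->
    tm_state * {ffun 'I_tm_work.+1 -> option (S + tm_extra) * direction}
}.

Section Run.
Variables (S : finType) (M : machine S).

Definition tm_config : Type :=
  tm_state M * {ffun 'I_(tm_work M).+1 -> tape (S + tm_extra M)}.

Definition tm_init (w : seq S) : tm_config :=
  (tm_start M,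
   [ffun i => if i == ord0 then ([::], [seq Some (inl a) | a <- w])
              else ([::], [::])]).

Definition tm_step (c : tm_config) : tm_config :=
  if tm_verdict c.1 is Some _ then c else
  let: (q, act) := tm_trans c.1 [ffun i => tape_read (c.2 i)] in
  (q, [ffun i => tape_move (act i).2 (tape_write (act i).1 (c.2 i))]).

Definition tm_run (t : nat) (w : seq S) : tm_config :=
  iter t tm_step (tm_init w).

End Run.

Definition language (S : finType) := seq S -> Prop.

Definition in_P (S : finType) (L : language S) : Prop :=
  exists (M : machine S) (p : {poly nat}), forall w : seq S,
  exists b : bool,
    tm_verdict (tm_run M p.[size w]%R w).1 = Some b /\ (b = true <-> L w).

(** * Allocations, EF1 and exchanges *)

Section Exchanges.
Variables (n m : nat) (u : 'I_n -> 'I_m -> nat).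

(* An ordered partition of the goods into [n] possibly empty bundles is
   represented by the function mapping each good to its owner. *)
Definition allocation := {ffun 'I_m -> 'I_n}.

Definition bundle (A : allocation) (i : 'I_n) : {set 'I_m} :=
  [set g | A g == i].

Definition utility (i : 'I_n) (X : {set 'I_m}) : nat := \sum_(g in X) u i g.

Definition EF1_towards (A : allocation) (i j : 'I_n) : Prop :=
  bundle A j = set0 \/
  exists2 g, g \in bundle A j &
    utility i (bundle A j :\ g) <= utility i (bundle A i).

Definition EF1 (A : allocation) : Prop :=
  forall i j : 'I_n, i != j -> EF1_towards A i j.

Definition exchange (A B : allocation) : Prop :=
  exists (i j : 'I_n) (g g' : 'I_m),
    [/\ i != j, g \in bundle A i & g' \in bundle A j] /\
    [/\ bundle B i = (bundle A i :|: [set g']) :\ g,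
        bundle B j = (bundle A j :|: [set g]) :\ g' &
        forall k : 'I_n, k != i -> k != j -> bundle B k = bundle A k].

Fixpoint exchanges (T : nat) (A B : allocation) : Prop :=
  if T is T'.+1 then exists2 C, exchange A C & exchanges T' C B else A = B.

Definition reaches_EF1 (A : allocation) (T : nat) : Prop :=
  exists2 B, exchanges T A B & EF1 B.

(* No [T] is optimal when no EF1 allocation is reachable: the optimal number of
   exchanges is then infinite. *)
Definition optimal_number (A : allocation) (T : nat) : Prop :=
  reaches_EF1 A T /\ forall T', reaches_EF1 A T' -> T <= T'.

End Exchanges.

(** * The decision problem and its binary encoding *)

Record oe_instance := OEInstance {
  agents : nat;
  goods : nat;
  agents_ge2 : 2 <= agents;
  goods_ge1 : 1 <= goods;
  value : 'I_agents -> 'I_goods -> nat;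
  initial : allocation agents goods;
  budget : nat
}.

Definition optimal_exchanges (I : oe_instance) : Prop :=
  exists2 T, optimal_number (@value I) (initial I) T & T <= budget I.

Definition two_agents (I : oe_instance) : Prop := agents I = 2.

Definition identical_utilities (I : oe_instance) : Prop :=
  forall (i j : 'I_(agents I)) (g : 'I_(goods I)), value i g = value j g.

(* Input alphabet: the two bits and two separators. *)
Definition letter : finType := (bool + bool)%type.
Definition bit (b : bool) : letter := inl b.
Definition comma : letter := inr false.
Definition semicolon : letter := inr true.

(* Binary numerals, least significant bit first, with no superfluous zeros on
   the most significant side; in particular 0 is written as the empty word. *)
Fixpoint positive_bits (p : positive) : seq bool :=
  match p with
  | xH => [:: true]
  | xO p' => false :: positive_bits p'
  | xI p' => true :: positive_bits p'
  end.

Definition numeral (x : nat) : seq letter :=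
  if bin_of_nat x is Npos p then map bit (positive_bits p) else [::].

Definition encode_good (I : oe_instance) (g : 'I_(goods I)) : seq letter :=
  numeral (initial I g) ++
  flatten [seq comma :: numeral (value i g) | i <- enum 'I_(agents I)] ++
  [:: semicolon].

(* [k;o_1,u_1(1),...,u_n(1);...;o_m,u_1(m),...,u_n(m);] where [o_g] is the
   initial owner of good [g] and [k] the budget, agents being numbered from 0.  The numbers of
   goods and (as there is at least one good) of agents are determined by the
   separators. *)
Definition encode (I : oe_instance) : seq letter :=
  numeral (budget I) ++
  semicolon :: flatten [seq encode_good g | g <- enum 'I_(goods I)].

(* The language of the yes-instances of Optimal Exchanges that satisfy [D];
   words that encode no instance are not in the language. *)
Definition optimal_exchanges_language (D : oe_instance -> Prop) :
    language letter :=
  fun w => exists I, [/\ D I, optimal_exchanges I & w = encode I].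

(* Main.v *)
From Corelib Require Import BinNums.
Require Import Defs.
From mathcomp Require Import all_boot all_algebra.
From mathcomp Require Import zify.

(* Fix an agent [i] and sort the goods by decreasing value.  Exchanging the least
   valuable good of [i] for the most valuable one of the other agent is optimal for
   [i]: if some bundle that differs from that of [i] in at most [T.+1] goods makes [i]
   EF1, then some bundle that differs in at most [T] goods from the new one does.  When
   [i] becomes EF1 after such an exchange, the other agent, who was envied before it, is
   EF1 too.  Hence an EF1 allocation is reachable with [k] exchanges iff, for both
   agents [i], [minn k m] greedy exchanges in favour of [i] make [i] EF1.  On the sorted
   list of owners a greedy exchange merely gives the first good of the other agent to
   [i] and then the last good of [i] to the other agent.  The test is performed by a
   structured program working on stacks, and each stack is a tape of the machine. *)

Set Implicit Arguments.
Unset Strict Implicit.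
Unset Printing Implicit Defensive.

(** * Structured programs on stacks *)

(** The cut-off [minn k m] keeps the running time polynomial: [k] is written in binary and may be
    exponential in the input, while two bundles of equal size differ in at most [m] goods.
    Optimality is proved by altering a target bundle rather than a sequence of exchanges: the target
    is modified, with its owner remaining EF1, until it agrees with the greedy exchange. Nothing
    depends on how ties are broken, so a greedy step is a relation, and the runs for the two agents
    may order equal goods differently. Receiving before giving spares a comparison of values: if the
    best good of the other agent is worth less than everything the favoured agent holds, it is the
    last good on the list after being received and goes straight back. *)

Variant op (G : Type) := Keep | Pop | Push of G | Put of G.
Arguments Keep {G}.
Arguments Pop {G}.

Definition act G (o : op G) (x : seq G) : seq G :=
  match o with
  | Keep => x
  | Pop => behead x
  | Push a => a :: x
  | Put a => a :: behead x
  end.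

Definition act_all G (o : nat -> op G) (s : seq (seq G)) : seq (seq G) :=
  mkseq (fun i => act (o i) (nth [::] s i)) (size s).

Definition tops G (s : seq (seq G)) : seq (option G) := map ohead s.

Inductive cmd (G : Type) :=
  | Do of seq (option G) -> nat -> op G
  | Reject
  | Seq of cmd G & cmd G
  | If of pred (seq (option G)) & cmd G & cmd G
  | While of pred (seq (option G)) & cmd G.
Arguments Reject {G}.

Section Control.
Variable G : Type.
Implicit Types c a b : cmd G.

(** The program points form a finite type because they become states of the machine. A test has a
    point of its own, [None], at which no stack changes. *)
Fixpoint point c : finType :=
  match c with
  | Do _ | Reject => unit
  | Seq a b => (point a + point b)%type
  | If _ a b => option (point a + point b)%type
  | While _ a => option (point a)
  end.

Fixpoint entry c : point c :=
  match c return point c with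
  | Do _ | Reject => tt
  | Seq a b => inl (entry a)
  | If _ a b => None
  | While _ a => None
  end.

Definition keep_all : nat -> op G := fun=> Keep.

(* The right summand is the outcome of a finished command: [true] if control
   passes on to the next command, [false] if the input is rejected. *)
Fixpoint ctrl c : point c -> seq (option G) -> (point c + bool) * (nat -> op G) :=
  match c return point c -> seq (option G) -> (point c + bool) * (nat -> op G) with
  | Do f => fun _ t => (inr true, f t)
  | Reject => fun _ _ => (inr false, keep_all)
  | Seq a b => fun q t =>
      match q with
      | inl q => let: (r, o) := ctrl q t in
          (match r with
           | inl q' => inl (inl q')
           | inr e => if e then inl (inr (entry b)) else inr false
           end, o)
      | inr q => let: (r, o) := ctrl q t in
          (match r with inl q' => inl (inr q') | inr e => inr e end, o)
      end
  | If p a b => fun q t =>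
      match q with
      | None => (inl (Some (if p t then inl (entry a) else inr (entry b))), keep_all)
      | Some (inl q) => let: (r, o) := ctrl q t in
          (match r with inl q' => inl (Some (inl q')) | inr e => inr e end, o)
      | Some (inr q) => let: (r, o) := ctrl q t in
          (match r with inl q' => inl (Some (inr q')) | inr e => inr e end, o)
      end
  | While p a => fun q t =>
      match q with
      | None => (if p t then inl (Some (entry a)) else inr true, keep_all)
      | Some q => let: (r, o) := ctrl q t in
          (match r with
           | inl q' => inl (Some q')
           | inr e => if e then inl None else inr false
           end, o)
      end
  end.

Inductive run c (q : point c) (s : seq (seq G)) : nat -> bool -> seq (seq G) -> Prop :=
  | run_exit e o : ctrl q (tops s) = (inr e, o) -> run q s 1 e (act_all o s)
  | run_step q' o n e s' : ctrl q (tops s) = (inl q', o) ->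
      run q' (act_all o s) n e s' -> run q s n.+1 e s'.

Lemma act_keep_all s : act_all keep_all s = s.
Proof. exact: mkseq_nth. Qed.

(** Here [n] is only an upper bound, so that costs can be rounded up; this is harmless because a
    halted machine stays halted. *)
Definition exec c s n (e : bool) s' := exists2 t, t <= n & run (entry c) s t e s'.

Lemma exec_le c s n n' e s' : n <= n' -> exec c s n e s' -> exec c s n' e s'.
Proof. by move=> le_nn' [t le_tn r]; exists t => //; apply: leq_trans le_nn'. Qed.

Lemma exec_do f s : exec (Do f) s 1 true (act_all (f (tops s)) s).
Proof. by exists 1 => //; apply: run_exit. Qed.

Lemma exec_do_eq f s s' : act_all (f (tops s)) s = s' -> exec (Do f) s 1 true s'.
Proof. by move=> <-; apply: exec_do. Qed.

Lemma exec_reject s : exec Reject s 1 false s.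
Proof. by exists 1 => //; rewrite -{2}(act_keep_all s); apply: run_exit. Qed.

Lemma run_seq_right a b (q : point b) s n e s1 :
  run q s n e s1 -> run (c := Seq a b) (inr q) s n e s1.
Proof.
elim=> {q s n e s1} [q s e o | q s q' o n e s1] h.
  by apply: run_exit; rewrite /= h.
by move=> _; apply: run_step; rewrite /= h.
Qed.

(** The last step of [a] already enters [b], so no step is spent in between. The run of [b] is
    quantified in the conclusion because it matters only if [a] does not reject. *)
Lemma run_seq_left a b (q : point a) s n e s1 :
  run q s n e s1 ->
  if e then forall n' e' s2, run (entry b) s1 n' e' s2 ->
    run (c := Seq a b) (inl q) s (n + n') e' s2
  else run (c := Seq a b) (inl q) s n e s1.
Proof.
elim=> {q s n e s1} [q s e o | q s q' o n e s1] h.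
  case: e h => h; last by apply: run_exit; rewrite /= h.
  by move=> n' e' s2 r; rewrite add1n; apply: run_step (run_seq_right a r); rewrite /= h.
move=> _; case: e => [IH n' e' s2 r | r]; rewrite ?addSn.
  by apply: run_step (IH _ _ _ r); rewrite /= h.
by apply: run_step r; rewrite /= h.
Qed.

Lemma run_if_left p a b (q : point a) s n e s1 :
  run q s n e s1 -> run (c := If p a b) (Some (inl q)) s n e s1.
Proof.
elim=> {q s n e s1} [q s e o | q s q' o n e s1] h.
  by apply: run_exit; rewrite /= h.
by move=> _; apply: run_step; rewrite /= h.
Qed.

Lemma run_if_right p a b (q : point b) s n e s1 :
  run q s n e s1 -> run (c := If p a b) (Some (inr q)) s n e s1.
Proof.
elim=> {q s n e s1} [q s e o | q s q' o n e s1] h.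
  by apply: run_exit; rewrite /= h.
by move=> _; apply: run_step; rewrite /= h.
Qed.

Lemma run_while p a (q : point a) s n e s1 :
  run q s n e s1 ->
  if e then forall n' e' s2, run (c := While p a) None s1 n' e' s2 ->
    run (c := While p a) (Some q) s (n + n') e' s2
  else run (c := While p a) (Some q) s n e s1.
Proof.
elim=> {q s n e s1} [q s e o | q s q' o n e s1] h.
  case: e h => h; last by apply: run_exit; rewrite /= h.
  by move=> n' e' s2 r; rewrite add1n; apply: run_step r; rewrite /= h.
move=> _; case: e => [IH n' e' s2 r | r]; rewrite ?addSn.
  by apply: run_step (IH _ _ _ r); rewrite /= h.
by apply: run_step r; rewrite /= h.
Qed.

Lemma exec_seq a b s n1 s1 n2 e s2 :
  exec a s n1 true s1 -> exec b s1 n2 e s2 -> exec (Seq a b) s (n1 + n2) e s2.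
Proof.
move=> [t1 le1 r1] [t2 le2 r2]; exists (t1 + t2); first exact: leq_add.
exact: (@run_seq_left a b _ _ _ true _ r1 _ _ _ r2).
Qed.

Lemma exec_seq_reject a b s n s1 :
  exec a s n false s1 -> exec (Seq a b) s n false s1.
Proof. by move=> [t le r]; exists t => //; apply: (run_seq_left b r). Qed.

Lemma exec_if (p : pred (seq (option G))) a b s n e s1 :
  exec (if p (tops s) then a else b) s n e s1 -> exec (If p a b) s n.+1 e s1.
Proof.
case=> t le r; exists t.+1 => //.
apply: (@run_step (If p a b) None s _ keep_all); first by [].
by rewrite act_keep_all; case: (p _) r => r; [apply: run_if_left | apply: run_if_right].
Qed.

Lemma exec_while_done (p : pred (seq (option G))) a s : ~~ p (tops s) -> exec (While p a) s 1
    true s.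
Proof.
move=> np; exists 1 => //; rewrite -{2}(act_keep_all s).
by apply: run_exit; rewrite /= (negbTE np).
Qed.

Lemma exec_while_step (p : pred (seq (option G))) a s n1 s1 n2 e s2 :
  p (tops s) -> exec a s n1 true s1 -> exec (While p a) s1 n2 e s2 ->
  exec (While p a) s (n1 + n2).+1 e s2.
Proof.
move=> ps [t1 le1 r1] [t2 le2 r2]; exists (t1 + t2).+1.
  by rewrite ltnS leq_add.
apply: (@run_step (While p a) None s (Some (entry a)) keep_all).
  by rewrite /= ps.
by rewrite act_keep_all; apply: (@run_while p a _ _ _ true _ r1 _ _ _ r2).
Qed.

Lemma exec_while_reject (p : pred (seq (option G))) a s n s1 :
  p (tops s) -> exec a s n false s1 -> exec (While p a) s n.+1 false s1.
Proof.
move=> ps [t le r]; exists t.+1 => //.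
apply: (@run_step (While p a) None s (Some (entry a)) keep_all).
  by rewrite /= ps.
by rewrite act_keep_all; apply: (@run_while p a _ _ _ _ _ r).
Qed.

End Control.

(* Stacks as tapes: the head is on the top of the stack and all the cells on its
   left are blank, so that a push takes two steps of the machine. *)
Section Compile.
Variables (S E : finType) (n : nat) (c : cmd (S + E)).
Local Notation G := (S + E)%type.

Definition first_half (o : op G) (x : option G) : option G * direction :=
  match o with
  | Keep => (x, Stay)
  | Pop => (None, Right)
  | Push _ => (x, Left)
  | Put a => (Some a, Stay)
  end.

Definition second_half (o : op G) : option G := if o is Push a then Some a else None.

Definition cstate : finType :=
  ((point c + bool) * option {ffun 'I_n.+1 -> option G})%type.

Definition ctrans (q : cstate) (r : {ffun 'I_n.+1 -> option G}) :
    cstate * {ffun 'I_n.+1 -> option G * direction} :=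
  match q.2, q.1 with
  | Some f, q' => ((q', None), [ffun i => (if f i is Some a then Some a else r i, Stay)])
  | None, inr e => ((inr e, None), [ffun i => (r i, Stay)])
  | None, inl q' =>
      let: (q1, o) := ctrl q' [seq r i | i <- enum 'I_n.+1] in
      ((q1, Some [ffun i : 'I_n.+1 => second_half (o i)]),
       [ffun i : 'I_n.+1 => first_half (o i) (r i)])
  end.

Definition compile : machine S :=
  @Machine S E n cstate (inl (entry c), None)
    (fun q => if q.2 is Some _ then None else if q.1 is inr e then Some e else None) ctrans.

(** Tapes are compared cell by cell with blank as default, because the same tape can be listed with
    different numbers of explicit blanks; a pop, for instance, leaves one on the left. *)
Definition represents (t : tape G) (x : seq G) :=
  (forall i, nth None t.1 i = None) /\ (forall i, nth None t.2 i = nth None (map Some x) i).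

Lemma represents_read t x : represents t x -> tape_read t = ohead x.
Proof. by case=> _ h; rewrite /tape_read -nth0 h; case: x {h}. Qed.

Lemma represents_step t x o : represents t x ->
  let t1 := tape_move (first_half o (tape_read t)).2 (tape_write (first_half o (tape_read
      t)).1 t) in
  represents (tape_move Stay
      (tape_write (if second_half o is Some a then Some a else tape_read t1) t1))
    (act o x).
Proof.
case: t => l r [/= hl hr];
    have hr' i : nth None (behead r) i = nth None (map Some (behead x)) i.
  by rewrite nth_behead hr -nth_behead; case: x {hr}.
have h0 : head None r = nth None (map Some x) 0 by rewrite -nth0 hr.
case: o => [||a|a]; split=> //=.
- by case=> [|i] /=; [exact: h0 | rewrite nth_behead hr].
- by case.
- by case=> [|i] /=; [rewrite -(hr' 0) nth0 | rewrite -(hr' i.+1) nth_behead].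
- by move=> i; rewrite nth_behead.
- case=> [|i] //=; rewrite -hr; case: i => [|i] /=; first by rewrite nth0.
  by rewrite nth_behead.
- by case=> [|i] //=.
Qed.

Definition represent (tp : {ffun 'I_n.+1 -> tape G}) (s : seq (seq G)) :=
  size s = n.+1 /\ forall i, represents (tp i) (nth [::] s i).

Local Notation step := (@tm_step _ compile).

Lemma compile_step (q : point c) tp s : represent tp s ->
  exists tp', represent tp' (act_all (ctrl q (tops s)).2 s) /\
    iter 2 step ((inl q, None), tp) = (((ctrl q (tops s)).1, None), tp').
Proof.
case=> size_s rep_s.
have read_tops : [seq [ffun i => tape_read (tp i)] i | i <- enum 'I_n.+1] = tops s.
  apply: (@eq_from_nth _ None); first by rewrite size_map size_enum_ord size_map.
  move=> i; rewrite size_map size_enum_ord => lt_i.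
  rewrite (nth_map ord0) ?size_enum_ord // ffunE (represents_read (rep_s _)).
  by rewrite (nth_map [::]) ?size_s // nth_enum_ord.
(* This is the first of the two machine steps. It records the symbols to be pushed in the state, and
   the second step writes them. *)
rewrite iterSr (_ : step _ = let: (q1, o) := ctrl q (tops s) in
    ((q1, Some [ffun i : 'I_n.+1 => second_half (o i)]),
     [ffun i : 'I_n.+1 => let a := first_half (o i) (tape_read (tp i)) in
       tape_move a.2 (tape_write a.1 (tp i))])); last first.
  rewrite -read_tops /tm_step /= /ctrans /=; case: (ctrl _ _) => q' o /=.
  by congr (_, _); apply/ffunP => i; rewrite !ffunE.
case: (ctrl q (tops s)) => q' o /=.
eexists; split; last by [].
split=> [|i]; first by rewrite size_mkseq.
rewrite !ffunE nth_mkseq ?size_s ?ltn_ord //=.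
exact: (represents_step _ (rep_s i)).
Qed.

Lemma compile_run (q : point c) s t e s' : run q s t e s' ->
  forall tp, represent tp s ->
  exists tp', iter (2 * t) step ((inl q, None), tp) = ((inr e, None), tp').
Proof.
elim=> {q s t e s'} [q s e o | q s q' o t e s'] h.
  move=> tp /(compile_step q); rewrite h /= => -[tp' [_ eq1]]; exists tp'.
  exact: eq1.
move=> _ IH tp /(compile_step q) [tp1 [rep1 eq1]]; rewrite h in rep1 eq1.
by have [tp' eq2] := IH _ rep1; exists tp'; rewrite mulnS addnC iterD eq1 eq2.
Qed.

Lemma compile_exec (w : seq S) t e s' :
  exec c (map inl w :: nseq n [::]) t e s' ->
  tm_verdict (tm_run compile (2 * t) w).1 = Some e.
Proof.
case=> t' le_t'; rewrite /tm_run => r.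
have rep0 : represent (tm_init compile w).2 (map inl w :: nseq n [::]).
  split=> [|i]; first by rewrite /= size_nseq.
  rewrite ffunE; case: (unliftP ord0 i) => [j ->|->] /=.
    by rewrite nth_nseq if_same; split=> k; rewrite ?nth_nil.
  by split=> k; rewrite ?nth_nil // -!map_comp.
have [tp' eq1] := compile_run r rep0.
rewrite -(subnK (leq_mul (leqnn 2) le_t')) iterD.
rewrite [X in iter (2 * t') _ X](_ : _ = ((inl (entry c), None), (tm_init compile w).2)) // eq1.
(* A configuration with a verdict is a fixed point of the step function, so the surplus steps change
   nothing. *)
by rewrite iter_fix.
Qed.

End Compile.

(** The polynomial is doubled because a program step takes two machine steps. *)
Lemma in_P_exec (S E : finType) n (c : cmd (S + E)) (p : {poly nat}) (L : language S) :
  (forall w, exists e s',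
    exec c (map inl w :: nseq n [::]) (p.[size w])%R e s' /\ (e = true <-> L w)) ->
  in_P L.
Proof.
move=> dec; exists (compile n c), (p + p)%R => w.
have [e [s' [ex eL]]] := dec w; exists e; split=> //.
have -> : (p + p).[size w]%R = 2 * p.[size w]%R by rewrite hornerD mul2n -addnn.
exact: compile_exec ex.
Qed.

(** * Moving symbols between stacks *)

Section Moves.
Variable G : Type.
Implicit Types (p : pred G) (c : cmd G) (s : seq (seq G)) (t : seq (option G)).

Lemma exec_eq c s n e s1 n' s' :
  exec c s n e s1 -> s1 = s' -> n <= n' -> exec c s n' e s'.
Proof. by move=> ex <- le; apply: exec_le ex. Qed.

Definition top i t := nth None t i.

Fixpoint ops (l : seq (nat * op G)) (i : nat) : op G :=
  if l is (j, o) :: l' then if eqn i j then o else ops l' i else Keep.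

Definition ends p i t := oapp p false (top i t).
Definition empty i t := ~~ top i t.

Definition move i j t :=
  if top i t is Some a then [:: (i, Pop); (j, Push a)] else [::].

Definition moves p i j := While (ends p i) (Do (fun t => ops (move i j t))).

Lemma nth_tops s i : nth None (tops s) i = ohead (nth [::] s i).
Proof.
have [lt|ge] := ltnP i (size s); first by rewrite (nth_map [::]).
by rewrite !nth_default ?size_map.
Qed.

Lemma nth_set s i x k :
  nth [::] (set_nth [::] s i x) k = if k == i then x else nth [::] s k.
Proof. exact: nth_set_nth. Qed.

(** The moved word arrives reversed, so words are usually moved twice. Every symbol costs a test and
    an action, and the failing test costs the last step. *)
Lemma exec_moves p s i j x r :
  i != j -> i < size s -> j < size s -> nth [::] s i = x ++ r ->
  all p x -> ~~ oapp p false (ohead r) ->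
  exec (moves p i j) s (2 * size x + 1) true
    (set_nth [::] (set_nth [::] s i r) j (rev x ++ nth [::] s j)).
Proof.
move=> ij lti ltj; elim: x s lti ltj => [|a x IH] s lti ltj si px pr.
  apply: exec_eq (exec_while_done _ _) _ _ => //.
    by rewrite /ends /top nth_tops si.
  apply: (@eq_from_nth _ [::]); first by rewrite !size_set_nth; lia.
  move=> k _; rewrite !nth_set.
  by case: eqP => [->|_] //; case: eqP => [->|].
case/andP: px => pa px.
have step : act_all (ops (move i j (tops s))) s =
    set_nth [::] (set_nth [::] s i (x ++ r)) j (a :: nth [::] s j).
  rewrite /move /top nth_tops si /=.
  apply: (@eq_from_nth _ [::]); first by rewrite size_mkseq !size_set_nth; lia.
  move=> k; rewrite size_mkseq => ltk.
  rewrite nth_mkseq // !nth_set !eqnE.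
  case: (eqVneq k i) => [->|_]; first by rewrite (negbTE ij) si.
  by case: (eqVneq k j) => [->|].
apply: exec_eq (exec_while_step _ (exec_do _ _) (IH _ _ _ _ px pr)) _ _ => //=.
- by rewrite /ends /top nth_tops si.
- by rewrite step !size_set_nth; lia.
- by rewrite step !size_set_nth; lia.
- by rewrite step !nth_set (negbTE ij) eqxx.
- rewrite step; apply: (@eq_from_nth _ [::]); first by rewrite !size_set_nth; lia.
  by move=> k _; rewrite !nth_set eqxx rev_cons cat_rcons; case: (k == j); case: (k == i).
- lia.
Qed.

End Moves.

Notation "a ;; b" := (Seq a b) (at level 90, right associativity).

Notation symbol := (letter + (bool * bool))%type.
Notation Bit b := (inl (inl b)).
Notation Tag b := (inl (inr b)).
(* One bit of each of the two sums of values, that of the favoured agent first. *)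
Notation Pair x y := (inr (x, y)).

(** * The decision procedure *)

Section Program.
Implicit Types (t : seq (option symbol)).

Definition is_bit (a : symbol) := if a is Bit _ then true else false.
Definition bit_of i t : bool := if top i t is Some (Bit b) then b else false.
Definition pair_of i t : bool * bool := if top i t is Some (inr p) then p else (false, false).
Definition shows i (a : symbol) t := top i t == Some a.
Definition move_bit i j t := if ends is_bit i t then move i j t else [::].

Definition skip : cmd symbol := Do (fun=> @keep_all _).
Definition require (p : pred (seq (option symbol))) := If p skip Reject.
Definition drain i j := moves (@predT symbol) i j.
Definition push i a : cmd symbol := Do (fun=> ops [:: (i, Push a)]).
Definition pop i : cmd symbol := Do (fun=> ops [:: (i, Pop)]).
Definition pops p i := While (ends p i) (pop i).
Definition clear i := pops predT i.

(* Stacks: 0 input, 1 what was read of it, 2 goods, 3 and 5 and 6 scratch, 4 held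
   good or sums, 7 flag, 8 budget, 9 one token per good, 10 sorted goods. *)

Definition read_bits : cmd symbol :=
  While (ends is_bit 0) (Do (fun t =>
    if top 0 t is Some a then ops [:: (0, Pop); (1, Push a); (5, Push a)] else @keep_all _)).

Definition expect (b : bool) :=
  require (shows 0 (Tag b)) ;; Do (fun=> ops [:: (0, Pop); (1, Push (Tag b))]).

(** Stack 5 receives the bits in reverse, so its top is the most significant one; refusing a zero
    there leaves only canonical numerals. *)
Definition read_numeral (b : bool) :=
  read_bits ;; require (predC (shows 5 (Bit false))) ;; expect b.

Definition reread : cmd symbol :=
  While (ends is_bit 0)
    (If (fun t => top 0 t == top 4 t)
      (Do (fun t => if top 0 t is Some a
        then ops [:: (0, Pop); (1, Push a); (4, Pop); (5, Push a)] else @keep_all _))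
      Reject).

(* Agent 1 is favoured if [role] holds, and agent 0 otherwise. *)
Definition read_owner (role : bool) :=
  If (empty 5) (push 7 (Tag role))
    (Do (fun=> ops [:: (5, Pop); (7, Push (Tag (~~ role)))])) ;;
  require (empty 5).

(** Identical utilities are tested here: the second value must repeat the first letter by letter,
    which for canonical numerals amounts to equality of the numbers. *)
Definition parse_good (role : bool) :=
  read_numeral false ;;
  read_owner role ;;
  read_numeral false ;;
  drain 5 4 ;;
  reread ;;
  require (empty 4) ;;
  expect true ;;
  drain 5 2 ;;
  Do (fun t => ops ((9, Push (Tag true)) :: move 7 2 t)).

Definition parse (role : bool) :=
  read_numeral true ;;
  drain 5 8 ;;
  While (predC (empty 0)) (parse_good role) ;;
  require (predC (empty 2)).

(** The scan starts at the least significant bits, and every difference overwrites the flag on 7, so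
    the most significant difference decides. An exhausted numeral reads as zeros, by the default of
    [bit_of]. *)
Definition compare_bits : cmd symbol :=
  While (predU (ends is_bit 2) (ends is_bit 4)) (Do (fun t =>
    ops ((7, Put (Bit (if bit_of 2 t == bit_of 4 t then bit_of 7 t else bit_of 2 t)))
      :: move_bit 2 5 t ++ move_bit 4 6 t))).

Definition hold_first : cmd symbol :=
  Do (fun t => ops (move 2 5 t)) ;; moves is_bit 2 5 ;; drain 5 4.

Definition keep_smaller : cmd symbol :=
  Do (fun t => ops ((7, Push (Bit true)) :: move 2 5 t ++ move 4 6 t)) ;;
  compare_bits ;;
  If (shows 7 (Bit true)) (drain 5 3 ;; drain 6 4) (drain 6 3 ;; drain 5 4) ;;
  pop 7.

(** Selection sort: successive minima are piled up on 10, which ends with the most valuable good on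
    top. Two drains keep a word in its orientation. *)
Definition extract_min : cmd symbol :=
  hold_first ;; While (predC (empty 2)) keep_smaller ;;
  drain 4 5 ;; drain 5 10 ;; drain 3 5 ;; drain 5 2.

Definition sort_goods := While (predC (empty 2)) extract_min.

(** Only tags are rewritten. The search for the last [Tag false] runs on the reversed list and needs
    no test for failure, since the good just received carries that tag. *)
Definition swap_extremes : cmd symbol :=
  moves (predC1 (Tag true : symbol)) 10 3 ;;
  If (empty 10) skip
    (Do (fun=> ops [:: (10, Pop); (3, Push (Tag false))]) ;; drain 10 3 ;;
     moves (predC1 (Tag false : symbol)) 3 10 ;;
     Do (fun=> ops [:: (3, Pop); (10, Push (Tag true))])) ;;
  drain 3 10.

(** Binary decrement of the budget: its low zeros wait on 5 as the ones they turn into. If no one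
    follows them, the budget was 0, and it stays 0 as the empty numeral. The tokens on 9 bound the
    number of rounds by the number of goods. *)
Definition spend_and_swap : cmd symbol :=
  pop 9 ;;
  While (shows 8 (Bit false)) (Do (fun=> ops [:: (8, Pop); (5, Push (Bit true))])) ;;
  If (shows 8 (Bit true))
    (Do (fun=> ops [:: (8, Put (Bit false))]) ;; drain 5 8 ;; swap_extremes)
    (clear 5).

Definition swaps := While (predC (empty 9)) spend_and_swap ;; clear 8.

Definition drop_richest : cmd symbol :=
  moves (predC1 (Tag true : symbol)) 10 3 ;; pop 10 ;;
  pops is_bit 10 ;; drain 3 10.

(** A full adder with its carry on 6. Both sums share one stack of pairs, and the tag on 7 selects
    the component that changes. *)
Definition add_bit t : nat -> op symbol :=
  let b := bit_of 10 t in
  let c := bit_of 6 t in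
  let: (x, y) := pair_of 4 t in
  let rich := shows 7 (Tag true) t in
  let old := if rich then y else x in
  let s := b (+) c (+) old in
  ops [:: (6, Put (Bit (b && c || b && old || c && old)));
          (5, Push (if rich then Pair x s else Pair s y));
          (4, Pop);
          (10, if ends is_bit 10 t then Pop else Keep)].

Definition add_bits : cmd symbol :=
  While (predU (ends is_bit 10) (predU (shows 6 (Bit true)) (predC (empty 4)))) (Do add_bit).

Definition add_good : cmd symbol :=
  Do (fun t => ops ((6, Push (Bit false)) :: move 10 7 t)) ;;
  add_bits ;;
  Do (fun=> ops [:: (6, Pop); (7, Pop)]) ;;
  drain 5 4.

Definition sum_goods := While (predC (empty 10)) add_good.

Definition compare_sums : cmd symbol :=
  push 7 (Bit true) ;;
  While (predC (empty 4)) (Do (fun t =>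
    let: (x, y) := pair_of 4 t in
    ops [:: (4, Pop); (7, Put (Bit (if x == y then bit_of 7 t else x)))])) ;;
  require (shows 7 (Bit true)) ;;
  pop 7.

Definition run_role (role : bool) :=
  parse role ;; sort_goods ;; swaps ;; drop_richest ;; sum_goods ;; compare_sums.

(** The first run consumes the input and leaves a reversed copy on stack 1; draining that copy
    restores the input for the run favouring the other agent. *)
Definition decide := run_role false ;; drain 1 0 ;; run_role true.

(** * Goods on stacks *)

(* The value of a good has its least significant bit first; the tag is [false] for
   the goods of the agent whom the greedy exchanges favour. *)
Definition good := (bool * seq bool)%type.
Implicit Types (x : seq bool) (g : good) (l : seq good).

Definition bits x : seq symbol := [seq Bit b | b <- x].
Definition good_word g : seq symbol := Tag g.1 :: bits g.2.
Definition word l := flatten (map good_word l).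
Definition numval x := foldr (fun (b : bool) v => b + v.*2) 0 x.

End Program.

(** * Effects and costs of the basic commands *)

Section Primitives.
Implicit Types (t : seq (option symbol)) (x : seq bool) (g h : good) (l : seq good).
Implicit Types (r i b k c o za zb : seq symbol).

Lemma size_bits x : size (bits x) = size x.
Proof. exact: size_map. Qed.

Lemma rev_good_word g : rev (good_word g) = rev (bits g.2) ++ [:: Tag g.1].
Proof. by rewrite rev_cons -cats1. Qed.

Lemma word_cat l1 l2 : word (l1 ++ l2) = word l1 ++ word l2.
Proof. by rewrite /word map_cat flatten_cat. Qed.

Lemma size_word_cat l1 l2 : size (word (l1 ++ l2)) = size (word l1) + size (word l2).
Proof. by rewrite word_cat size_cat. Qed.

Lemma size_word_cons g l : size (word (g :: l)) = (size g.2).+1 + size (word l).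
Proof. by rewrite /word /= size_cat size_bits. Qed.

Lemma all_is_bit x : all is_bit (bits x).
Proof. by elim: x. Qed.

(** A numeral is followed by a tag or by nothing, which is why loops over bits stop at the boundary
    between two goods. *)
Lemma hd_word l : ~~ oapp is_bit false (ohead (word l)).
Proof. by case: l. Qed.

Lemma exec_drain s (i j : nat) : i != j -> i < size s -> j < size s ->
  exec (drain i j) s (2 * size (nth [::] s i) + 1) true
    (set_nth [::] (set_nth [::] s i [::]) j (rev (nth [::] s i) ++ nth [::] s j)).
Proof.
by move=> ij lti ltj; apply: exec_moves; rewrite ?cats0 ?all_predT.
Qed.

Lemma exec_pops p s (i : nat) y (r : seq symbol) : i < size s -> nth [::] s i = y ++ r ->
  all p y -> ~~ oapp p false (ohead r) ->
  exec (pops p i) s (2 * size y + 1) true (set_nth [::] s i r).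
Proof.
elim: y s => [|a y IH] s lti si px pr.
  apply: exec_eq (exec_while_done _ _) _ _ => //.
    by rewrite /ends /top nth_tops si.
  by rewrite -[r]si; apply: (@eq_from_nth _ [::]) => [|j _]; rewrite ?size_set_nth ?nth_set;
      [lia | case: eqP => // ->].
case/andP: px => pa px.
have step : act_all (ops [:: (i, @Pop symbol)]) s = set_nth [::] s i (y ++ r).
  apply: (@eq_from_nth _ [::]); first by rewrite size_mkseq !size_set_nth; lia.
  move=> j; rewrite size_mkseq => ltj.
  by rewrite nth_mkseq // !nth_set /= eqnE; case: eqP => // ->; rewrite si.
apply: exec_eq (exec_while_step _ (exec_do _ _) (IH _ _ _ px pr)) _ _ => //=.
- by rewrite /ends /top nth_tops si.
- by rewrite step !size_set_nth; lia.
- by rewrite step nth_set eqxx.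
- rewrite step; apply: (@eq_from_nth _ [::]); first by rewrite !size_set_nth; lia.
  by move=> j _; rewrite !nth_set; case: eqP.
- lia.
Qed.

Lemma exec_clear s (i : nat) : i < size s ->
  exec (clear i) s (2 * size (nth [::] s i) + 1) true (set_nth [::] s i [::]).
Proof. by move=> lti; apply: exec_pops; rewrite ?cats0 ?all_predT. Qed.

Lemma exec_require (p : pred (seq (option symbol))) s :
  exec (require p) s 2 (p (tops s)) s.
Proof.
apply: exec_if; case: (p _); last exact: exec_reject.
by rewrite -{2}(act_keep_all s); apply: exec_do.
Qed.

(** The induction is on the total length, as either numeral may run out first. The initial flag [f]
    survives only if the numbers are equal, since a higher difference overrides all lower ones. *)
Lemma exec_compare_bits x y i b r T za zb f k c o :
  ~~ oapp is_bit false (ohead r) ->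
  exec compare_bits [:: i; b; bits x ++ r; T; bits y; za; zb; [:: Bit f]; k; c; o]
    (2 * (size x + size y) + 1) true
    [:: i; b; r; T; [::]; rev (bits x) ++ za; rev (bits y) ++ zb;
        [:: Bit (if numval x == numval y then f else numval y < numval x)]; k; c; o].
Proof.
move=> hr.
have [n] := ubnP (size x + size y); elim: n => // n IH in x y za zb f *.
case: x y => [|a x] [|d y] lt_n.
- apply: exec_eq (exec_while_done _ _) _ _ => //.
  by rewrite /= /ends /top /=; case: r hr {IH} => [|[[]|] r].
- apply: exec_eq (exec_while_step _ (exec_do_eq _)
    (IH [::] y za (Bit d :: zb) (if false == d then f else false) _)) _ _.
  + by rewrite /= /ends /top /= orbT.
  + by case: r hr {IH} => [|[[]|] r].
  + by move: lt_n => /=; lia.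
  + by rewrite /= rev_cons cat_rcons; congr [:: _; _; _; _; _; _; _; [:: Bit _]; _; _; _];
        case: d {lt_n}; case: f; do ?case: eqP; rewrite /=; lia.
  + by rewrite /=; lia.
- apply: exec_eq (exec_while_step _ (exec_do_eq _)
    (IH x [::] (Bit a :: za) zb (if a == false then f else a) _)) _ _.
  + by [].
  + by [].
  + by move: lt_n => /=; lia.
  + by rewrite /= rev_cons cat_rcons; congr [:: _; _; _; _; _; _; _; [:: Bit _]; _; _; _];
        case: a {lt_n}; case: f; do ?case: eqP; rewrite /=; lia.
  + by rewrite /=; lia.
- apply: exec_eq (exec_while_step _ (exec_do_eq _)
    (IH x y (Bit a :: za) (Bit d :: zb) (if a == d then f else a) _)) _ _.
  + by [].
  + by [].
  + by move: lt_n => /=; lia.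
  + by rewrite /= !rev_cons !cat_rcons; congr [:: _; _; _; _; _; _; _; [:: Bit _]; _; _; _];
        case: a {lt_n}; case: d; case: f; do ?case: eqP; rewrite /=; lia.
  + by rewrite /=; lia.
Qed.

Lemma exec_require_true (p : pred (seq (option symbol))) s :
  p (tops s) -> exec (require p) s 2 true s.
Proof. by move=> ps; have := exec_require p s; rewrite ps. Qed.

Lemma exec_require_false (p : pred (seq (option symbol))) s :
  ~~ p (tops s) -> exec (require p) s 2 false s.
Proof. by move=> ps; have := exec_require p s; rewrite (negbTE ps). Qed.

End Primitives.

Ltac first_do := eapply exec_seq; [exact: exec_do | rewrite /act_all /mkseq /=].
Ltac first_drain := eapply exec_seq; [by apply: exec_drain | rewrite /=].
Ltac last_do := eapply exec_do_eq; rewrite /act_all /mkseq /=; reflexivity.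

(* The same size may occur with several convertible element types, which [nia]
   would not identify. *)
Ltac size_nia :=
  repeat match goal with |- context [size ?x] => move: (size x) => ? end; nia.

(** * Sorting the goods *)

Section Sorting.
Implicit Types (t : seq (option symbol)) (x : seq bool) (g h : good) (l : seq good).
Implicit Types (r i b k c o za zb : seq symbol).

Lemma size_word_ge l : size l <= size (word l).
Proof. by elim: l => // g l; rewrite size_word_cons /=; lia. Qed.

Lemma exec_hold_first i b g l T k c o :
  exec hold_first [:: i; b; word (g :: l); T; [::]; [::]; [::]; [::]; k; c; o]
    (4 * size (good_word g) + 3) true
    [:: i; b; word l; T; good_word g; [::]; [::]; [::]; k; c; o].
Proof.
apply: exec_eq.
- first_do.
  eapply exec_seq.
    by apply: (exec_moves (x := bits g.2) (r := word l)); rewrite ?all_is_bit ?hd_word.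
  by rewrite /=; apply: exec_drain.
- by rewrite /= cats0 -rev_good_word revK.
- by rewrite /= size_cat size_rev size_bits /=; lia.
Qed.

Lemma exec_keep_smaller i b g h l (ts : seq good) k c o :
  let lt := numval g.2 < numval h.2 in
  exec keep_smaller
    [:: i; b; word (g :: l); word ts; good_word h; [::]; [::]; [::]; k; c; o]
    (4 * (size (good_word g) + size (good_word h)) + 10) true
    [:: i; b; word l; word ((if lt then h else g) :: ts);
        good_word (if lt then g else h); [::]; [::]; [::]; k; c; o].
Proof.
move=> lt; apply: exec_eq.
- first_do; eapply exec_seq; first exact: (exec_compare_bits _ _ _ _ _ _ _ _ _ _ _ (hd_word l)).
  rewrite /= -!rev_good_word.
  rewrite (_ : (if _ == _ then _ else _) = ~~ lt); last by rewrite /lt; case: eqP => *; lia.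
  eapply (@exec_seq _ _ _ _ _ [:: i; b; word l; word ((if lt then h else g) :: ts);
        good_word (if lt then g else h); [::]; [::]; [:: Bit (~~ lt)]; k; c; o]);
            last by last_do.
  apply: exec_if; rewrite [X in if X then _ else _](_ : _ = ~~ lt); last by case: lt.
  instantiate (1 := (2 * (size (good_word g) + size (good_word h)) + 2)).
  case: lt => /=.
    apply: exec_eq.
    - by first_drain; apply: exec_drain.
    - by rewrite /= !revK cats0.
    - by rewrite /= !size_rev /=; lia.
  apply: exec_eq.
  - by first_drain; apply: exec_drain.
  - by rewrite /= !revK cats0.
  - by rewrite /= !size_rev /=; lia.
- by [].
- by rewrite /= !size_bits; lia.
Qed.

(** Invariant: the held good is worth at most every good set aside in [ts]. The bound [N] stays
    fixed during the induction, so all rounds share one cost estimate. *)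
Lemma exec_keep_smallest N i b h l (ts : seq good) k c o :
  size (word (h :: l)) <= N -> all (fun g => numval h.2 <= numval g.2) ts ->
  exists h' ts',
    [/\ exec (While (predC (empty 2)) keep_smaller)
          [:: i; b; word l; word ts; good_word h; [::]; [::]; [::]; k; c; o]
          ((8 * N + 20) * size l + 1) true
          [:: i; b; [::]; word ts'; good_word h'; [::]; [::]; [::]; k; c; o],
        perm_eq (h' :: ts') (h :: l ++ ts) &
        all (fun g => numval h'.2 <= numval g.2) ts'].
Proof.
elim: l h ts => [|g l IH] h ts le_N hts.
  by exists h, ts; split=> //; apply: exec_eq (exec_while_done _ _) _ _; rewrite /= ?muln0.
set lt := numval g.2 < numval h.2.
have [||h' [ts' [ex pm al]]] := IH (if lt then g else h) ((if lt then h else g) :: ts).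
- by move: le_N; rewrite !size_word_cons; case: lt => /=; lia.
- rewrite /= {2}/lt; move: hts; rewrite /lt; case: ltnP => [lt1|le1] hts; last by rewrite le1.
  by rewrite ltnW //; apply: sub_all hts => f; lia.
exists h', ts'; split=> //.
  apply: exec_eq (exec_while_step _ (exec_keep_smaller _ _ _ _ _ _ _ _ _) ex) _ _ => //.
  rewrite /= !size_bits; move: le_N; rewrite !size_word_cons; lia.
apply: perm_trans pm _; case: (lt); apply/permP => p /=; rewrite !count_cat /=; lia.
Qed.

Lemma exec_extract_min i b g l k c o :
  exists h l',
    [/\ exec extract_min
          [:: i; b; word (g :: l); [::]; [::]; [::]; [::]; [::]; k; c; o]
          ((8 * size (word (g :: l)) + 50) * (size l).+1) true
          [:: i; b; word l'; [::]; [::]; [::]; [::]; [::]; k; c; good_word h ++ o],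
        perm_eq (h :: l') (g :: l) &
        all (fun f => numval h.2 <= numval f.2) l'].
Proof.
have [||h [l' [ex pm al]]] := @exec_keep_smallest (size (word (g :: l))) i b g l [::] k c o =>
    //.
have sz : size (word (h :: l')) = size (word (g :: l)).
  by rewrite cats0 in pm; rewrite /word !size_flatten /shape; apply: perm_sumn;
      do 2!apply: perm_map.
exists h, l'; split=> //; last by rewrite cats0 in pm.
apply: exec_eq.
- eapply exec_seq; first exact: exec_hold_first.
  eapply exec_seq; first exact: ex.
  rewrite /=; first_drain; first_drain; first_drain; by apply: exec_drain.
- by rewrite /= !cats0 !revK.
- move: sz; rewrite !size_word_cons => sz /=; rewrite !(size_rev, size_cat) /= !size_bits;
      move: sz; size_nia.
Qed.

Definition richer g h := numval h.2 <= numval g.2.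

Lemma richer_trans : transitive richer.
Proof. by rewrite /richer => y x z; lia. Qed.

(** Invariant: the goods already on 10 are sorted, and each remaining good is worth at least as much
    as all of them, so the next minimum belongs on top. *)
Lemma exec_sort_goods N i b l (os : seq good) k c :
  size (word l) <= N -> sorted richer os ->
  all (fun g => all (fun h => richer g h) os) l ->
  exists os',
    [/\ exec sort_goods
          [:: i; b; word l; [::]; [::]; [::]; [::]; [::]; k; c; word os]
          (((8 * N + 50) * N + 1) * size l + 1) true
          [:: i; b; [::]; [::]; [::]; [::]; [::]; [::]; k; c; word os'],
        perm_eq os' (l ++ os) & sorted richer os'].
Proof.
have [n] := ubnP (size l); elim: n => // n IH in l os *.
case: l => [|g l] lt_n le_N so al.
  by exists os; split=> //; apply: exec_eq (exec_while_done _ _) _ _; rewrite /= ?muln0.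
have [h [l' [ex pm mn]]] := exec_extract_min i b g l k c (word os).
have sz : size (word (h :: l')) = size (word (g :: l)).
  by rewrite /word !size_flatten /shape; apply: perm_sumn; do 2!apply: perm_map.
have sl : size l' = size l by case: (perm_size pm).
have al' := al; rewrite -(perm_all _ pm) /= in al'; case/andP: al' => alh al'.
have [||||os' [ex' pm' so']] := IH l' (h :: os).
- by rewrite sl; move: lt_n => /=; lia.
- by move: sz le_N; rewrite !size_word_cons; lia.
- by rewrite /= path_sortedE ?so ?alh //; apply: richer_trans.
- by apply/allP => f fl; apply/andP; split; [exact: (allP mn) | exact: (allP al')].
exists os'; split=> //.
  apply: exec_eq (exec_while_step _ ex ex') _ _ => //.
  (* This nonlinear bound on the cost of one extraction is handed to [nia], which would have to
     guess the product. *)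
  have := leq_mul (leq_add (leq_mul (leqnn 8) le_N) (leqnn 50)) (leq_trans (size_word_ge (g ::
      l)) le_N).
  rewrite sl /=; size_nia.
apply: perm_trans pm' _; rewrite -cat1s catA perm_cat2r.
by apply: perm_trans pm; rewrite perm_catC.
Qed.

End Sorting.

(** * Exchanges *)

Section Exchanging.
Implicit Types (t : seq (option symbol)) (x : seq bool) (g h : good) (l : seq good).
Implicit Types (r i b k c o za zb : seq symbol).

(** * Swaps on tagged lists with arbitrary contents *)

Section Flip.
Variable T : Type.
Implicit Types (s : seq (bool * T)).

Definition of_role (e : bool) (p : bool * T) := p.1 == e.

Fixpoint flip e s :=
  if s is p :: s' then if of_role e p then (~~ e, p.2) :: s' else p :: flip e s'
  else [::].

(** The second flip sees the result of the first. If the good just received is the last of the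
    favoured agent, the two flips cancel and the list is unchanged. *)
Definition swap_ends s :=
  if has (of_role true) s then rev (flip false (rev (flip true s))) else s.

Fixpoint drop_first s :=
  if s is p :: s' then if of_role true p then s' else p :: drop_first s' else [::].

Lemma flipP e s : has (of_role e) s ->
  exists s1 y s2,
    [/\ s = s1 ++ (e, y) :: s2, ~~ has (of_role e) s1 & flip e s = s1 ++ (~~ e, y) :: s2].
Proof.
elim: s => // -[d y] s IH /=; case: ifP => [/eqP /= <- _|ne /= /IH [s1 [z [s2 [-> h ->]]]]].
  by exists [::], y, s.
by exists ((d, y) :: s1), z, s2; split=> //=; rewrite ne.
Qed.

Lemma drop_firstP s : has (of_role true) s ->
  exists s1 y s2,
    [/\ s = s1 ++ (true, y) :: s2, ~~ has (of_role true) s1 & drop_first s = s1 ++ s2].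
Proof.
elim: s => // -[d y] s IH /=; case: ifP => [/eqP /= -> _|ne /= /IH [s1 [z [s2 [-> h ->]]]]].
  by exists [::], y, s.
by exists ((d, y) :: s1), z, s2; split=> //=; rewrite ne.
Qed.

Lemma drop_first_id s : ~~ has (of_role true) s -> drop_first s = s.
Proof. by elim: s => //= p s IH; rewrite negb_or => /andP[/negbTE -> /IH ->]. Qed.

(** The good [z] given away may lie on either side of the received good [y] or coincide with it. The
    two decompositions are therefore linked only by an equation for the intermediate list. *)
Lemma swap_endsP s : has (of_role true) s ->
  exists s1 y s2 s3 z s4,
    [/\ s = s1 ++ (true, y) :: s2, ~~ has (of_role true) s1,
        s1 ++ (false, y) :: s2 = s3 ++ (false, z) :: s4, ~~ has (of_role false) s4 &
        swap_ends s = s3 ++ (true, z) :: s4].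
Proof.
move=> hs; rewrite /swap_ends hs; have [s1 [y [s2 [es h1 ->]]]] := flipP hs.
have : has (of_role false) (rev (s1 ++ (false, y) :: s2)).
  by rewrite has_rev has_cat /= orbT.
case/flipP => s4 [z [s3 [/(congr1 rev) es' h4 ->]]].
exists s1, y, s2, (rev s3), z, (rev s4); split=> //.
- by rewrite -[LHS]revK es' rev_cat rev_cons cat_rcons.
- by rewrite has_rev.
- by rewrite rev_cat rev_cons cat_rcons.
Qed.
End Flip.

Lemma no_tag_word e l : ~~ has (of_role e) l -> all (predC1 (Tag e : symbol)) (word l).
Proof.
elim: l => //= -[d x] l IH; rewrite negb_or => /andP[ne /IH hl].
have {}ne : predC1 (Tag e : symbol) (Tag d) := ne.
by rewrite /word /= all_cat -/(word l) hl andbT; apply/andP; split=> //; elim: x.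
Qed.

Lemma exec_swap_extremes i b l k c :
  exec swap_extremes
    [:: i; b; [::]; [::]; [::]; [::]; [::]; [::]; k; c; word l]
    (8 * size (word l) + 20) true
    [:: i; b; [::]; [::]; [::]; [::]; [::]; [::]; k; c; word (swap_ends l)].
Proof.
have [hl|hl] := boolP (has (of_role true) l); last first.
  rewrite /swap_ends (negbTE hl); apply: exec_eq.
  - eapply exec_seq.
      apply: (exec_moves (x := word l) (r := [::])) => //=; rewrite ?cats0 //.
      exact: no_tag_word.
    rewrite /=; eapply exec_seq; first by apply: exec_if; apply: exec_do.
    by rewrite act_keep_all; apply: exec_drain.
  - by rewrite /= !cats0 revK.
  - by rewrite /= cats0 size_rev; lia.
have [s1 [y [s2 [s3 [z [s4 [el h1 es h4 ->]]]]]]] := swap_endsP hl.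
apply: exec_eq.
- eapply exec_seq.
    apply: (exec_moves (x := word s1) (r := word ((true, y) :: s2))) => //=.
    by rewrite el word_cat.
    exact: no_tag_word.
  rewrite /=; eapply exec_seq.
    apply: exec_if => /=; first_do; first_drain.
    eapply exec_seq.
      (* On the reversed stack the bits of a good precede its tag, so those of [z] are moved before
         the search stops. *)
      apply: (exec_moves (x := rev (bits z ++ word s4)) (r := Tag false :: rev (word s3))) =>
          //=.
        have := congr1 (fun s => rev (word s)) es.
        rewrite !word_cat /word /= -!/(word _) !(rev_cat, rev_cons) !cats0 -!cats1 -!catA => ->.
        by rewrite !catA.
      rewrite all_rev all_cat no_tag_word // andbT.
      by elim: z {es}.
    rewrite /=; last_do.
  rewrite /=; apply: exec_drain => //.
- by rewrite /= !cats0 !revK word_cat.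
- have sz : size (word l) = size (word s3) + (size z).+1 + size (word s4).
    have : size (word (s1 ++ (false, y) :: s2)) = size (word (s3 ++ (false, z) :: s4)) by
        rewrite es.
     rewrite el !size_word_cat !size_word_cons /=; lia.
  have sz' : size (word l) = size (word s1) + (size y).+1 + size (word s2).
    by rewrite el size_word_cat size_word_cons /=; lia.
  by rewrite /= !(size_rev, size_cat) /= !size_bits; move: sz sz'; size_nia.
Qed.

Lemma size_word_swap l : size (word (swap_ends l)) = size (word l).
Proof.
have [hl|hl] := boolP (has (of_role true) l); last by rewrite /swap_ends (negbTE hl).
have [s1 [y [s2 [s3 [z [s4 [-> _ es _ ->]]]]]]] := swap_endsP hl.
have : size (word (s1 ++ (false, y) :: s2)) = size (word (s3 ++ (false, z) :: s4)) by rewrite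
    es.
by rewrite !size_word_cat !size_word_cons /=; lia.
Qed.

(** The rule of binary decrement: the lowest one becomes a zero, and the zeros below it become
    ones. *)
Lemma borrow x : numval x = 0 /\ x = nseq (size x) false \/
  exists n y, [/\ x = nseq n false ++ true :: y &
    numval x = (numval (nseq n true ++ false :: y)).+1].
Proof.
elim: x => [|[] x IH]; first by left.
  by right; exists 0, x; split=> //=; lia.
case: IH => [[nx ex]|[n [y [ex nx]]]]; [left | right].
  by rewrite /= nx -ex.
by exists n.+1, y; rewrite /= -ex nx; split=> //=; lia.
Qed.

Lemma bits_nseq n e : bits (nseq n e) = nseq n (Bit e).
Proof. exact: map_nseq. Qed.

Lemma exec_borrow n i b (r : seq symbol) c o za : ohead r != Some (Bit false) ->
  exec (While (shows 8 (Bit false)) (Do (fun=> ops [:: (8, Pop); (5, Push (Bit true))])))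
    [:: i; b; [::]; [::]; [::]; za; [::]; [::]; nseq n (Bit false) ++ r; c; o]
    (2 * n + 1) true
    [:: i; b; [::]; [::]; [::]; nseq n (Bit true) ++ za; [::]; [::]; r; c; o].
Proof.
move=> hr; elim: n za => [|n IH] za.
  by apply: exec_eq (exec_while_done _ _) _ _; rewrite /= /shows /top.
apply: exec_eq (exec_while_step _ (exec_do_eq _) (IH (Bit true :: za))) _ _ => //.
- by congr [:: _; _; _; _; _; _; _; _; _; _; _]; elim: (n) => //= m ->.
- lia.
Qed.

Lemma exec_spend_and_swap i b l x a c :
  exists x',
    [/\ exec spend_and_swap
          [:: i; b; [::]; [::]; [::]; [::]; [::]; [::]; bits x; a :: c; word l]
          (8 * size (word l) + 4 * size x + 50) true
          [:: i; b; [::]; [::]; [::]; [::]; [::]; [::]; bits x'; c;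
              word (if numval x == 0 then l else swap_ends l)],
        size x' <= size x & numval x' = (numval x).-1].
Proof.
case: (borrow x) => [[nx ex]|[n [y [ex nx]]]].
  have eb : bits x = nseq (size x) (Bit false) ++ [::] by rewrite cats0 -bits_nseq -ex.
  exists [::]; split; rewrite ?nx //; rewrite eb; apply: exec_eq.
  - first_do; eapply exec_seq.
      by apply: exec_borrow.
    by rewrite /=; apply: exec_if; apply: exec_clear.
  - by [].
  - by rewrite /= cats0 size_nseq; lia.
exists (nseq n true ++ false :: y); split; last 2 first.
- by rewrite ex !size_cat /= !size_nseq.
- by rewrite nx.
have eb : bits x = nseq n (Bit false) ++ Bit true :: bits y.
  by rewrite ex /bits map_cat map_nseq.
rewrite nx eb; apply: exec_eq.
- first_do; eapply exec_seq.
    by apply: exec_borrow.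
  rewrite /=; apply: exec_if => /=; first_do; first_drain; exact: exec_swap_extremes.
- by rewrite cats0 rev_nseq /bits map_cat /= map_nseq.
- by rewrite /= cats0 size_nseq ex size_cat size_nseq /=; lia.
Qed.

Lemma exec_swaps N i b l x c : size (word l) + size x <= N ->
  exec swaps
    [:: i; b; [::]; [::]; [::]; [::]; [::]; [::]; bits x; c; word l]
    ((8 * N + 51) * size c + 2 * N + 2) true
    [:: i; b; [::]; [::]; [::]; [::]; [::]; [::]; [::]; [::];
        word (iter (minn (numval x) (size c)) (@swap_ends _) l)].
Proof.
move=> le_N.
have [x' [ex le_x']] : exists x', exec (While (predC (empty 9)) spend_and_swap)
    [:: i; b; [::]; [::]; [::]; [::]; [::]; [::]; bits x; c; word l]
    ((8 * N + 51) * size c + 1) true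
    [:: i; b; [::]; [::]; [::]; [::]; [::]; [::]; bits x'; [::];
        word (iter (minn (numval x) (size c)) (@swap_ends _) l)] /\ size x' <= size x.
  elim: c x l le_N => [|a c IH] x l le_N.
    exists x; split=> //; rewrite minn0; apply: exec_eq (exec_while_done _ _) _ _ => //; lia.
  have [x1 [ex1 sz1 nx1]] := exec_spend_and_swap i b l x a c.
  have [|x' [ex' sz']] := IH x1 (if numval x == 0 then l else swap_ends l).
    by apply: leq_trans le_N; case: ifP => _; rewrite ?size_word_swap leq_add2l.
  exists x'; split; last by lia.
  apply: exec_eq (exec_while_step _ ex1 ex') _ _ => //; last by rewrite /=; move: le_N;
      size_nia.
  rewrite nx1; case: (numval x) => [|m] /=; first by rewrite !min0n.
  by rewrite minnSS -iterSr.
apply: exec_eq.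
- eapply exec_seq; first exact: ex.
  by apply: exec_clear.
- by [].
- by rewrite /= size_bits; lia.
Qed.

Lemma exec_drop_richest i b l :
  exec drop_richest
    [:: i; b; [::]; [::]; [::]; [::]; [::]; [::]; [::]; [::]; word l]
    (6 * size (word l) + 10) true
    [:: i; b; [::]; [::]; [::]; [::]; [::]; [::]; [::]; [::]; word (drop_first l)].
Proof.
have [hl|hl] := boolP (has (of_role true) l); last first.
  rewrite drop_first_id //; apply: exec_eq.
  - eapply exec_seq.
      apply: (exec_moves (x := word l) (r := [::])) => //=; rewrite ?cats0 //.
      exact: no_tag_word.
    rewrite /=; first_do; eapply exec_seq.
      by apply: (exec_pops (y := [::]) (r := [::])).
    by apply: exec_drain.
  - by rewrite /= !cats0 revK.
  - by rewrite /= cats0 size_rev; lia.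
have [s1 [y [s2 [el h1 ->]]]] := drop_firstP hl.
apply: exec_eq.
- eapply exec_seq.
    apply: (exec_moves (x := word s1) (r := word ((true, y) :: s2))) => //=.
    by rewrite el word_cat.
    exact: no_tag_word.
  rewrite /=; first_do; eapply exec_seq.
    by apply: (exec_pops (y := bits y) (r := word s2)); rewrite ?all_is_bit ?hd_word.
  by apply: exec_drain.
- by rewrite /= !cats0 !revK word_cat.
- have sz' : size (word l) = size (word s1) + (size y).+1 + size (word s2).
    by rewrite el size_word_cat size_word_cons /=; lia.
  by rewrite /= !(size_rev, size_cat) /= !size_bits; move: sz'; size_nia.
Qed.

End Exchanging.

(** * Sums *)

Section Adding.
Implicit Types (t : seq (option symbol)) (x : seq bool) (g h : good) (l : seq good).
Implicit Types (r i b k o za zb : seq symbol) (a : seq (bool * bool)).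

Definition pairs a : seq symbol := [seq inr p | p <- a].
Definition side e a := numval [seq (if e then p.2 else p.1) | p <- a].

Lemma add_bitE e i b r x a za (f : bool) : ~~ oapp is_bit false (ohead r) ->
  let d := head false x in let p := head (false, false) a in
  let old := if e then p.2 else p.1 in let s := d (+) f (+) old in
  let st := [:: i; b; [::]; [::]; pairs a; za; [:: Bit f]; [:: Tag e]; [::]; [::];
      bits x ++ r] in
  act_all (add_bit (tops st)) st =
    [:: i; b; [::]; [::]; pairs (behead a); inr (if e then (p.1, s) else (s, p.2)) :: za;
        [:: Bit (d && f || d && old || f && old)]; [:: Tag e]; [::]; [::];
            bits (behead x) ++ r].
Proof. by case: r => [|[[?|?]|?] r] // _; case: x => [|d x]; case: a => [|[p1 p2] a];
    case: e. Qed.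

Lemma numval_head x : numval x = head false x + (numval (behead x)).*2.
Proof. by case: x. Qed.

Lemma side_cons e p a : side e (p :: a) = (if e then p.2 else p.1) + (side e a).*2.
Proof. by []. Qed.

Lemma side_head e a : side e a =
  (if e then (head (false, false) a).2 else (head (false, false) a).1) + (side e (behead a)).*2.
Proof. by case: a => //; case: e. Qed.

(** A carry arises from no carry only where both operands lose a bit, so total length plus carry
    decreases. The same measure bounds the length of the result and keeps repeated sums linear in
    the input. *)
Lemma exec_add_bits e i b r x a za (f : bool) :
  ~~ oapp is_bit false (ohead r) ->
  exists a',
    [/\ exec add_bits
          [:: i; b; [::]; [::]; pairs a; za; [:: Bit f]; [:: Tag e]; [::]; [::]; bits x ++ r]
          (2 * (size x + size a + f) + 1) true
          [:: i; b; [::]; [::]; [::]; rev (pairs a') ++ za; [:: Bit false]; [:: Tag e]; [::];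
              [::]; r],
        size a' <= size x + size a + f, side e a' = numval x + f + side e a &
        side (~~ e) a' = side (~~ e) a].
Proof.
move=> hr; have [n] := ubnP (size x + size a + f); elim: n => // n IH in x a za f *.
have [|nz] := boolP [&& size x == 0, size a == 0 & ~~ f].
  case/and3P => /nilP -> /nilP -> /negbTE -> _; exists [::]; split=> //.
  apply: exec_eq (exec_while_done _ _) _ _ => //.
  by rewrite /= /ends /shows /empty /top /=; case: r hr {IH} => [|[[]|] r].
move=> lt_n; have st := add_bitE e i b x a za f hr; move: st => /=.
set p := head _ a; set d := head _ x; set old := if e then p.2 else p.1.
set f' := _ || _ && _; set p' := if e then (_, _) else _ => st.
have lt : size (behead x) + size (behead a) + f' < size x + size a + f.
  by move: nz; rewrite /f' /d /old /p; case: (x) => [|[] ?]; case: (a) => [|[[] []] ?];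
      case: (f); case: (e) => //= _; size_nia.
have [|a' [ex sz ne ne']] := IH (behead x) (behead a) (inr p' :: za) f'.
  by apply: leq_trans lt _.
exists (p' :: a'); split.
- apply: exec_eq (exec_while_step _ (exec_do_eq st) ex) _ _ => //.
  + move: nz; case: (x) => [|d0 x0]; last by [].
    rewrite /= /ends /shows /empty /top /=; case: (a) => [|p0 a0] //=; last by rewrite !orbT.
    by case: (f) => //; rewrite orbT.
  + by rewrite /= rev_cons cat_rcons.
  + by move: lt; size_nia.
- by move: sz lt => /=; size_nia.
- rewrite side_cons ne (numval_head x) (side_head e a) -/p -/d -/old.
  have -> : (if e then p'.2 else p'.1) = d (+) f (+) old by rewrite /p'; case: (e).
  by rewrite /f'; case: (d); case: (f); case: (old) => /=; lia.
- rewrite side_cons ne' (side_head _ a) -/p /p'; by case: (e).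
Qed.

Lemma exec_add_good i b g l a :
  exists a',
    [/\ exec add_good
          [:: i; b; [::]; [::]; pairs a; [::]; [::]; [::]; [::]; [::]; word (g :: l)]
          (4 * (size g.2 + size a) + 10) true
          [:: i; b; [::]; [::]; pairs a'; [::]; [::]; [::]; [::]; [::]; word l],
        size a' <= size g.2 + size a, side g.1 a' = numval g.2 + side g.1 a &
        side (~~ g.1) a' = side (~~ g.1) a].
Proof.
have [a' [ex sz ne ne']] := exec_add_bits g.1 i b g.2 a [::] false (hd_word l).
rewrite !addn0 in sz ne ex.
exists a'; split=> //; apply: exec_eq.
- first_do; eapply exec_seq; first exact: ex.
  first_do; by apply: exec_drain.
- by rewrite /= !cats0 revK.
- have sp : size (pairs a') = size a' := size_map _ _.
  by rewrite /= cats0 size_rev sp; move: sz; size_nia.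
Qed.

Definition total e l := \sum_(g <- l | of_role e g) numval g.2.

Lemma exec_sum_goods N i b l a : size (word l) + size a <= N ->
  exists a',
    [/\ exec sum_goods
          [:: i; b; [::]; [::]; pairs a; [::]; [::]; [::]; [::]; [::]; word l]
          ((4 * N + 11) * size l + 1) true
          [:: i; b; [::]; [::]; pairs a'; [::]; [::]; [::]; [::]; [::]; [::]],
        size a' <= size (word l) + size a & forall e, side e a' = total e l + side e a].
Proof.
elim: l a => [|g l IH] a le_N.
  exists a; split=> //; last by move=> e; rewrite /total big_nil.
  by apply: exec_eq (exec_while_done _ _) _ _; rewrite /= ?muln0.
have [a1 [ex1 sz1 ne ne']] := exec_add_good i b g l a.
rewrite size_word_cons in le_N.
have [|a' [ex sz tot]] := IH a1; first by move: sz1 le_N; size_nia.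
exists a'; split.
- apply: exec_eq (exec_while_step _ ex1 ex) _ _ => //; move: sz1 le_N => /=; size_nia.
- by rewrite size_word_cons; move: sz1 sz; size_nia.
move=> e; rewrite tot /total big_cons /of_role.
case: eqP => [<-|/eqP ge]; first by rewrite ne; lia.
have -> : e = ~~ g.1 by case: (e) (g.1) ge => [] [].
by rewrite ne'.
Qed.

Lemma exec_compare_sums i b a :
  exec compare_sums
    [:: i; b; [::]; [::]; pairs a; [::]; [::]; [::]; [::]; [::]; [::]]
    (2 * size a + 10) (side true a <= side false a)
    (if side true a <= side false a
     then [:: i; b; [::]; [::]; [::]; [::]; [::]; [::]; [::]; [::]; [::]]
     else [:: i; b; [::]; [::]; [::]; [::]; [::]; [:: Bit false]; [::]; [::]; [::]]).
Proof.
have ex f : exec (While (predC (empty 4)) (Do (fun t =>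
    let: (x, y) := pair_of 4 t in
    ops [:: (4, Pop); (7, Put (Bit (if x == y then bit_of 7 t else x)))])))
  [:: i; b; [::]; [::]; pairs a; [::]; [::]; [:: Bit f]; [::]; [::]; [::]]
  (2 * size a + 1) true
  [:: i; b; [::]; [::]; [::]; [::]; [::];
    [:: Bit (if side true a == side false a then f else side true a < side false a)];
    [::]; [::]; [::]].
  elim: a f => [|[x y] a IH] f.
    by apply: exec_eq (exec_while_done _ _) _ _.
  apply: exec_eq (exec_while_step _ (exec_do_eq _) (IH (if x == y then f else x))) _ _ => //.
  - congr [:: _; _; _; _; _; _; _; [:: Bit _]; _; _; _]; rewrite !side_cons /=.
    by case: x; case: y; case: f; do ?case: eqP; rewrite /=; lia.
  - by rewrite /=; lia.
have {}ex := ex true.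
rewrite (_ : (if _ == _ then _ else _) = (side true a <= side false a)) in ex; last first.
  by case: eqP => *; lia.
case: leqP ex => h ex.
  apply: exec_eq.
  - first_do; eapply exec_seq; first exact: ex.
    eapply exec_seq; first exact: exec_require.
    last_do.
  - by [].
  - by rewrite /=; lia.
apply: exec_eq.
- first_do; eapply exec_seq; first exact: ex.
  apply: exec_seq_reject; exact: exec_require.
- by [].
- by rewrite /=; lia.
Qed.

End Adding.

(** * Parsing *)

Section Parsing.
Implicit Types (t : seq (option symbol)) (x y : seq bool) (g : good) (l : seq good).
Implicit Types (i b h k o s za zb : seq symbol) (w r : seq letter).

Definition emb w : seq symbol := [seq inl a | a <- w].
Definition letters x : seq letter := [seq bit e | e <- x].
Definition canonical x := last true x.

(** The owner is written as [nseq g.1 true] because the numerals of 0 and 1 are the empty word and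
    the single bit [true]. *)
Definition good_code g : seq letter :=
  letters (nseq g.1 true) ++ comma :: letters g.2 ++ comma :: letters g.2 ++ [:: semicolon].

Definition goods_code l := flatten [seq good_code g | g <- l].

Definition no_bit w := if w is inl _ :: _ then false else true.

Lemma span w : exists x r, w = letters x ++ r /\ no_bit r.
Proof.
elim: w => [|[e|e] w [x [r [-> nr]]]]; first by exists [::], [::].
  by exists (e :: x), r.
by exists [::], (inr e :: letters x ++ r).
Qed.

(** Unique readability of the encoding rests on this: a numeral ends at the next separator. It
    serves both the refusal of malformed words and the injectivity of [code]. *)
Lemma span_uniq x r y r' : no_bit r -> no_bit r' ->
  letters x ++ r = letters y ++ r' -> x = y /\ r = r'.
Proof.
move=> nr nr'; elim: x y => [|d x IH] [|e y] //=.
- by move=> er; move: nr; rewrite er.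
- by move=> er; move: nr'; rewrite -er.
by case=> -> /IH [-> ->].
Qed.

Lemma emb_cat w w' : emb (w ++ w') = emb w ++ emb w'.
Proof. exact: map_cat. Qed.

Lemma emb_letters x : emb (letters x) = bits x.
Proof. by rewrite /emb -map_comp. Qed.

Lemma exec_read_bits x r b s T h za zb f k c o : no_bit r ->
  exec read_bits [:: bits x ++ emb r; b; s; T; h; za; zb; f; k; c; o]
    (2 * size x + 1) true
    [:: emb r; rev (bits x) ++ b; s; T; h; rev (bits x) ++ za; zb; f; k; c; o].
Proof.
move=> nr; elim: x b za => [|d x IH] b za.
  apply: exec_eq (exec_while_done _ _) _ _ => //.
  by case: r nr => [|[]].
apply: exec_eq (exec_while_step _ (exec_do_eq _) (IH (Bit d :: b) (Bit d :: za))) _ _ => //.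
- by rewrite /= !rev_cons !cat_rcons.
- by rewrite /=; lia.
Qed.

(** The specification of a parsing command: acceptance yields a decoding and the resulting stacks,
    whereas rejection comes with a proof that no decoding exists. *)
Variant decides (A : Type) (P : A -> Prop) (c : cmd symbol) st n (next : A -> seq (seq
    symbol)) : Prop :=
  | Accepted a of P a & exec c st n true (next a)
  | Rejected st' of (forall a, ~ P a) & exec c st n false st'.

Lemma top_numeral x : ohead (rev (bits x)) != Some (Bit false) = canonical x.
Proof. by case/lastP: x => // x [];
    rewrite /canonical last_rcons /bits map_rcons rev_rcons. Qed.

Lemma exec_read_numeral e w b s T h zb f k c o :
  decides (fun p => canonical p.1 /\ w = letters p.1 ++ inr e :: p.2)
    (read_numeral e) [:: emb w; b; s; T; h; [::]; zb; f; k; c; o] (2 * size w + 10)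
    (fun p => [:: emb p.2; Tag e :: rev (bits p.1) ++ b; s; T; h; rev (bits p.1); zb; f; k; c;
        o]).
Proof.
have [x [r [-> nr]]] := span w; rewrite emb_cat emb_letters.
have ex1 := exec_read_bits x b s T h [::] zb f k c o nr.
rewrite cats0 in ex1.
have [cx|ncx] := boolP (canonical x); last first.
  eapply Rejected.
    by move=> [y r'] /= [cy /span_uniq [//|//|eq_xy _]]; rewrite -eq_xy (negbTE ncx) in cy.
  apply: exec_le; last first.
    eapply exec_seq; first exact: ex1.
    by apply/exec_seq_reject/exec_require_false; rewrite /= /shows /top /= top_numeral.
  by rewrite size_cat size_map; lia.
have [er|ner] := eqVneq (ohead r) (Some (inr e : letter)).
  case: r nr er ex1 => //= a r nr [ea] ex1; subst a.
  apply: (@Accepted _ _ _ _ _ _ (x, r)) => //; apply: exec_eq.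
  - eapply exec_seq; first exact: ex1.
    eapply exec_seq; first by apply: exec_require_true; rewrite /= /shows /top /= top_numeral.
    eapply exec_seq; first by apply: exec_require_true; rewrite /shows /top /= eqxx.
    by last_do.
  - by [].
  - by rewrite size_cat size_map; lia.
eapply Rejected.
  by move=> [y r'] /= [cy /span_uniq [//|//|_ er]]; rewrite er eqxx in ner.
apply: exec_le; last first.
  eapply exec_seq; first exact: ex1.
  eapply exec_seq; first by apply: exec_require_true; rewrite /= /shows /top /= top_numeral.
  apply/exec_seq_reject/exec_require_false; rewrite /shows /top /=.
  by case: r ner {nr ex1}.
by rewrite size_cat size_map; lia.
Qed.

Lemma good_code_cat g r : good_code g ++ r =
  letters (nseq g.1 true) ++ comma :: letters g.2 ++ comma :: letters g.2 ++ semicolon :: r.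
Proof. by rewrite /good_code -!(catA, cat_cons). Qed.

Lemma numeral_uniq x y (e f : bool) r r' :
  letters x ++ inr e :: r = letters y ++ inr f :: r' -> [/\ x = y, e = f & r = r'].
Proof. by case/span_uniq => // -> [-> ->]. Qed.

(** Canonicity forces a numeral of one letter to be the bit [true], so counting letters suffices to
    recognise the owners 0 and 1. *)
Lemma exec_read_owner role x i b s k c : canonical x ->
  decides (fun e : bool => x = nseq e true) (read_owner role)
    [:: i; b; s; [::]; [::]; rev (bits x); [::]; [::]; k; c; [::]] 4
    (fun e => [:: i; b; s; [::]; [::]; [::]; [::]; [:: Tag (e (+) role)]; k; c; [::]]).
Proof.
rewrite /read_owner; case: x => [|f [|d x]] cx.
- apply: (@Accepted _ _ _ _ _ _ false) => //; apply: exec_eq.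
  + eapply exec_seq; first by apply: exec_if; apply: exec_do.
    exact: exec_require_true.
  + by [].
  + by [].
- rewrite [f]cx; apply: (@Accepted _ _ _ _ _ _ true) => //; apply: exec_eq.
  + eapply exec_seq; first by apply: exec_if; apply: exec_do.
    exact: exec_require_true.
  + by [].
  + by [].
- have ne : behead (rev (bits [:: f, d & x])) != [::].
    by rewrite /= !rev_cons; case: (rev _) => [|? [|]].
  have net : empty 5 (tops [:: i; b; s; [::]; [::]; rev (bits [:: f, d & x]); [::]; [::]; k;
      c; [::]]) = false.
    by rewrite /empty /top /=; case: (rev _) ne.
  eapply Rejected; first by case; case: (f).
  apply: exec_le; last first.
    eapply exec_seq; first by apply: exec_if; rewrite net; apply: exec_do.
    by apply: exec_require_false; rewrite /empty /top /=; case: (behead _) ne.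
  by [].
Qed.

Lemma exec_reread x y r b s za f k c : no_bit r ->
  decides (fun x' => x = y ++ x') reread
    [:: bits y ++ emb r; b; s; [::]; bits x; za; [::]; f; k; c; [::]] (3 * size y + 3)
    (fun x' => [:: emb r; rev (bits y) ++ b; s; [::]; bits x'; rev (bits y) ++ za; [::]; f; k;
        c; [::]]).
Proof.
move=> nr; elim: y x b za => [|d y IH] x b za.
  apply: (@Accepted _ _ _ _ _ _ x) => //.
  apply: exec_eq (exec_while_done _ _) _ _ => //.
  by case: r nr => [|[]].
have [[x' ->]|nx] : (exists x', x = d :: x') \/ ohead (bits x) != Some (Bit d).
- case: x => [|e x]; first by right.
  by have [->|ne] := eqVneq e d; [left; exists x | right].
- have [x'' -> ex|st' no ex] := IH x' (Bit d :: b) (Bit d :: za).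
    apply: (@Accepted _ _ _ _ _ _ x'') => //.
    apply: exec_eq (exec_while_step _ _ ex) _ _ => //.
    + apply: exec_if; rewrite /top /= eqxx; exact: exec_do.
    + by rewrite /= !rev_cons !cat_rcons.
    + by rewrite /=; lia.
  eapply Rejected; first by move=> x'' [/no].
  apply: exec_le; last first.
    eapply exec_while_step; first by [].
      by apply: exec_if; rewrite /top /= eqxx; apply: exec_do.
    exact: ex.
  by rewrite /=; lia.
eapply Rejected; first by move=> x'' ex; rewrite ex eqxx in nx.
apply: exec_le; last first.
  eapply exec_while_reject; first by [].
  by apply: exec_if; rewrite /top /= eq_sym (negbTE nx); apply: exec_reject.
by lia.
Qed.

Definition assign role g : good := (g.1 (+) role, g.2).

Lemma exec_parse_good role w b s k c :
  decides (fun p : good * seq letter => canonical p.1.2 /\ w = good_code p.1 ++ p.2)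
    (parse_good role)
    [:: emb w; b; s; [::]; [::]; [::]; [::]; [::]; k; c; [::]] (20 * size w + 60)
    (fun p => [:: emb p.2; rev (emb (good_code p.1)) ++ b; good_word (assign role p.1) ++ s;
       [::]; [::]; [::]; [::]; [::]; k; Tag true :: c; [::]]).
Proof.
case: (exec_read_numeral false w b s [::] [::] [::] [::] k c [::]) => [[x1 w1] /= [cx1 ew]
    ex1|st1 no ex1]; last first.
  eapply Rejected; last by apply: exec_le (exec_seq_reject _ ex1); lia.
  move=> [g r] /= [cg]; rewrite good_code_cat => eg; apply: (no (nseq g.1 true, _)).
  by split; [case: (g.1) | exact: eg].
have sz1 : size w = (size x1 + size w1).+1 by rewrite ew size_cat size_map /=; lia.
case: (exec_read_owner role (emb w1) (Tag false :: rev (bits x1) ++ b) s k c cx1) => [e ex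
    ex2|st2 no ex2]; last first.
  eapply Rejected; last by apply: exec_le (exec_seq ex1 (exec_seq_reject _ ex2)); lia.
  by move=> [g r] /= [cg]; rewrite good_code_cat ew => /numeral_uniq[/no].
case: (exec_read_numeral false w1 (Tag false :: rev (bits x1) ++ b) s [::] [::] [::] [:: Tag
    (e (+) role)] k c [::])
  => [[x2 w2] /= [cx2 ew1] ex3|st3 no ex3]; last first.
  eapply Rejected;
      last by apply: exec_le (exec_seq ex1 (exec_seq ex2 (exec_seq_reject _ ex3))); move: sz1;
      size_nia.
  move=> [g r] /= [cg]; rewrite good_code_cat ew => /numeral_uniq[_ _ eg].
  by apply: (no (g.2, _)); split; [exact: cg | exact: eg].
have sz2 : size w1 = (size x2 + size w2).+1 by rewrite ew1 size_cat size_map /=; lia.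
have ex4 := @exec_drain [:: emb w2;
    Tag false :: rev (bits x2) ++ Tag false :: rev (bits x1) ++ b; s; [::]; [::];
    rev (bits x2); [::]; [:: Tag (e (+) role)]; k; c; [::]] 5 4 isT isT isT.
rewrite /= revK cats0 size_rev size_bits in ex4.
have [y [w3 [ew2 nw3]]] := span w2.
have sz3 : size w2 = size y + size w3 by rewrite ew2 size_cat size_map.
case: (exec_reread x2 y (Tag false :: rev (bits x2) ++ Tag false :: rev (bits x1) ++ b) s [::]
    [:: Tag (e (+) role)] k c nw3)
  => [x' ex' ex5|st5 no ex5]; rewrite -emb_letters -emb_cat -ew2 in ex5; last first.
  eapply Rejected;
      last by apply: exec_le (exec_seq ex1 (exec_seq ex2 (exec_seq ex3 (exec_seq ex4
      (exec_seq_reject _ ex5))))); move: sz1 sz2 sz3; size_nia.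
  move=> [g r] /= [cg]; rewrite good_code_cat ew ew1 ew2.
  case/numeral_uniq => _ _ /numeral_uniq[e2 _ /span_uniq [//|//|e3 _]].
  by apply: (no [::]); rewrite cats0 e2 e3.
(* A nonempty [x'] means that the second value is a proper prefix of the first. *)
have [x'0|x'n] := eqVneq x' [::]; last first.
  eapply Rejected; last first.
    apply: exec_le (exec_seq ex1 (exec_seq ex2 (exec_seq ex3 (exec_seq ex4 (exec_seq ex5
        (exec_seq_reject _ (exec_require_false _))))))); first by move: sz1 sz2 sz3; size_nia.
    by case: (x') x'n.
  move=> [g r] /= [cg]; rewrite good_code_cat ew ew1 ew2.
  case/numeral_uniq => _ _ /numeral_uniq[e2 _ /span_uniq [//|//|e3 _]].
  move: x'n; rewrite -size_eq0; have := congr1 size ex'; rewrite e2 e3 size_cat; size_nia.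
rewrite x'0 !cats0 emb_letters in ex' ex5; rewrite -ex' in ew2 ex5 sz3.
have [hw3|hw3] := eqVneq (ohead w3) (Some semicolon); last first.
  eapply Rejected; last first.
    apply: exec_le (exec_seq ex1 (exec_seq ex2 (exec_seq ex3 (exec_seq ex4 (exec_seq ex5
        (exec_seq (exec_require_true _) (exec_seq_reject _ (exec_seq_reject _
        (exec_require_false _))))))))) => //; first by move: sz1 sz2 sz3; size_nia.
    by case: (w3) hw3.
  move=> [g r] /= [cg]; rewrite good_code_cat ew ew1 ew2.
  case/numeral_uniq => _ _ /numeral_uniq[e2 _ /span_uniq [//|//|_ e3]].
  by rewrite e3 eqxx in hw3.
case: w3 hw3 nw3 ew2 sz3 ex5 => // a r [ea] _ ew2 sz3 ex5; subst a.
apply: (@Accepted _ _ _ _ _ _ ((e, x2), r)) => /=.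
  by rewrite good_code_cat ew ew1 ew2 ex.
apply: exec_eq.
- apply: (exec_seq ex1 (exec_seq ex2 (exec_seq ex3 (exec_seq ex4 (exec_seq ex5 (exec_seq
      (exec_require_true _) (exec_seq (exec_seq (exec_require_true _) (exec_do _ _)) (exec_seq
      (exec_drain _ _ _) (exec_do _ _))))))))) => //.
- rewrite /act_all /mkseq /= revK /good_code /emb !(map_cat, map_cons) /= -!/(emb _)
      !emb_letters ex.
  by rewrite !(rev_cat, rev_cons) -!cats1 -!catA.
- by rewrite /= size_rev size_bits; move: sz1 sz2 sz3 => /=; size_nia.
Qed.

Lemma size_good_code g : size (good_code g) = g.1 + (size g.2).*2 + 3.
Proof. by rewrite /good_code !(size_cat, size_map, size_nseq) /= !(size_cat, size_map) /=
    !(size_cat, size_map) /=; size_nia. Qed.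

(** The goods pile up in reverse order, which does not matter as they are sorted next. Stack 9 gains
    one token for each of them. *)
Lemma exec_parse_goods role w b s k c :
  decides (fun l => all (fun g => canonical g.2) l /\ w = goods_code l)
    (While (predC (empty 0)) (parse_good role))
    [:: emb w; b; s; [::]; [::]; [::]; [::]; [::]; k; c; [::]]
    ((20 * size w + 62) * size w + 62)
    (fun l => [:: [::]; rev (emb w) ++ b; word (rev (map (assign role) l)) ++ s;
       [::]; [::]; [::]; [::]; [::]; k; nseq (size l) (Tag true) ++ c; [::]]).
Proof.
have [n] := ubnP (size w); elim: n => // n IH in w b s c *; move=> lt_n.
have [->|nw] := eqVneq w [::].
  apply: (@Accepted _ _ _ _ _ _ [::]) => //.
  by apply: exec_eq (exec_while_done _ _) _ _.
have test : predC (empty 0) (tops [:: emb w; b; s; [::]; [::]; [::]; [::]; [::]; k; c; [::]]).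
  by case: (w) nw.
case: (exec_parse_good role w b s k c) => [[g r] /= [cg ew] ex|st no ex]; last first.
  eapply Rejected; last by apply: exec_le (exec_while_reject test ex); move: (size w); nia.
  move=> [|g l] [] /=; first by move=> _ ew; rewrite ew in nw.
  by case/andP=> cg cl ew; apply: (no (g, goods_code l)).
have sz : size w = size (good_code g) + size r by rewrite ew size_cat.
have := size_good_code g => szg.
case: (IH r (rev (emb (good_code g)) ++ b) (good_word (assign role g) ++ s) (Tag true :: c)).
- by lia.
- move=> l [cl er] ex'; apply: (@Accepted _ _ _ _ _ _ (g :: l)).
    by rewrite /= cg cl ew er.
  apply: exec_eq (exec_while_step test ex ex') _ _.
  + congr [:: _; _; _; _; _; _; _; _; _; _; _].
    * by rewrite ew (emb_cat (good_code g)) rev_cat -catA.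
    * by rewrite [X in _ = word (rev X) ++ _]map_cons rev_cons -cats1 word_cat -catA /word /=
          cats0.
    * by rewrite /=; elim: (size l) => //= m ->.
  + by move: sz szg; move: (size w) (size r); nia.
move=> st no ex'; eapply Rejected; last first.
  apply: exec_le (exec_while_step test ex ex').
  by move: sz szg; move: (size w) (size r); nia.
move=> [|g' l] [] /=; first by move=> _ ew'; rewrite ew' in nw.
case/andP=> cg' cl ew'; apply: (no l); split=> //.
move: ew'; rewrite ew /goods_code /= !good_code_cat.
by case/numeral_uniq => _ _ /numeral_uniq[_ _ /numeral_uniq[_ _]].
Qed.

Definition code (d : seq bool * seq good) : seq letter :=
  letters d.1 ++ semicolon :: goods_code d.2.

(** These are the decodings that come from instances with two identical agents; the list is nonempty
    because an instance has at least one good. *)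
Definition well_formed (d : seq bool * seq good) :=
  [&& canonical d.1, d.2 != [::] & all (fun g => canonical g.2) d.2].

Lemma exec_parse role w :
  decides (fun d => well_formed d /\ w = code d)
    (parse role)
    [:: emb w; [::]; [::]; [::]; [::]; [::]; [::]; [::]; [::]; [::]; [::]]
    ((20 * size w + 66) * size w + 80)
    (fun d => [:: [::]; rev (emb w); word (rev (map (assign role) d.2));
       [::]; [::]; [::]; [::]; [::]; bits d.1; nseq (size d.2) (Tag true); [::]]).
Proof.
case: (exec_read_numeral true w [::] [::] [::] [::] [::] [::] [::] [::] [::]) => [[x w1] /=
    [cx ew] ex1|st1 no ex1]; last first.
  eapply Rejected; last by apply: exec_le (exec_seq_reject _ ex1); move: (size w); nia.
  by move=> [x l] [] /and3P[cx _ _] ew; apply: (no (x, goods_code l)).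
have sz1 : size w = (size x + size w1).+1 by rewrite ew size_cat size_map /=; lia.
rewrite cats0 in ex1.
have ex2 := @exec_drain [:: emb w1; Tag true :: rev (bits x); [::]; [::]; [::]; rev (bits x);
    [::]; [::]; [::]; [::]; [::]] 5 8 isT isT isT.
rewrite /= revK cats0 size_rev size_bits in ex2.
case: (exec_parse_goods role w1 (Tag true :: rev (bits x)) [::] (bits x) [::]) => [l [cl ew1]
    ex3|st no ex3]; last first.
  eapply Rejected; last first.
    apply: exec_le (exec_seq ex1 (exec_seq ex2 (exec_seq_reject _ ex3))).
    by move: sz1; move: (size w) (size w1) (size x); nia.
  move=> [y l] [] /and3P[cy _ cl]; rewrite ew => /numeral_uniq[_ _ ew1].
  by apply: (no l).
have [l0|ln] := eqVneq l [::].
  eapply Rejected; last first.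
    apply: exec_le (exec_seq ex1 (exec_seq ex2 (exec_seq ex3 (exec_require_false _)))).
      by move: sz1; move: (size w) (size w1) (size x); nia.
    by rewrite l0.
  move=> [y m] [] /and3P[cy nm cm]; rewrite ew => /numeral_uniq[_ _ /=]; rewrite ew1 l0.
  by case: m nm cm cy => // g m _ _ _; rewrite /goods_code /= good_code_cat; case: (g.1).
apply: (@Accepted _ _ _ _ _ _ (x, l)).
  by rewrite /well_formed cx ln cl ew ew1.
apply: exec_eq.
- apply: (exec_seq ex1 (exec_seq ex2 (exec_seq ex3 (exec_require_true _)))).
  rewrite /= /empty /top /= cats0; case/lastP: l ln {cl ew1 ex3} => // l g _.
  by rewrite map_rcons rev_rcons.
- by rewrite !cats0 ew emb_cat /= emb_letters rev_cat rev_cons cat_rcons.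
- by move: sz1; move: (size w) (size w1) (size x); nia.
Qed.

(* On a sorted list, [drop_first] removes the most valuable good of the other agent,
   the one that EF1 allows to disregard. *)
Definition greedy_ok n l :=
  let l' := drop_first (iter n (@swap_ends _) l) in total true l' <= total false l'.

Lemma size_word_goods_code role l : size (word (rev (map (assign role) l))) <= size
    (goods_code l).
Proof.
elim: l => // g l IH; rewrite /= rev_cons -cats1 size_word_cat size_word_cons /=.
rewrite /goods_code /= size_cat size_good_code -/(goods_code l).
by move: IH; size_nia.
Qed.

(** The cubic bound stems from the selection sort; the other phases are at most quadratic. The final
    stacks are prescribed only after acceptance, since otherwise nothing is executed afterwards. *)
Lemma exec_run_role role w :
  (exists d l e st, [/\ well_formed d, w = code d,
     perm_eq l (map (assign role) d.2) /\ sorted richer l,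
     e = greedy_ok (minn (numval d.1) (size d.2)) l &
     exec (run_role role)
       [:: emb w; [::]; [::]; [::]; [::]; [::]; [::]; [::]; [::]; [::]; [::]]
       (200 * (size w).+1 ^ 3) e st /\
     (e -> st = [:: [::]; rev (emb w); [::]; [::]; [::]; [::]; [::]; [::]; [::]; [::];
         [::]])]) \/
  (forall d, ~ (well_formed d /\ w = code d)) /\
  (exists st, exec (run_role role)
       [:: emb w; [::]; [::]; [::]; [::]; [::]; [::]; [::]; [::]; [::]; [::]]
       (200 * (size w).+1 ^ 3) false st).
Proof.
case: (exec_parse role w) => [[x l0] [/= wf ew] ex1|st no ex1]; [left | right]; last first.
  split=> //; exists st; apply: exec_le (exec_seq_reject _ ex1).
  rewrite !expnS expn0; move: (size w); nia.
have sz : (size x + size (goods_code l0)).+1 = size w by rewrite ew size_cat size_map /=; lia.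
set l1 := rev (map (assign role) l0) in ex1.
have sz1 : size (word l1) <= size (goods_code l0) := size_word_goods_code _ _.
have szl : size l1 <= size (word l1) := size_word_ge _.
have szl1 : size l1 = size l0 by rewrite size_rev size_map.
have le1 : size (word l1) <= size w by move: sz sz1; size_nia.
have nil_ok : all (fun g => all (richer g) [::]) l1 by apply/allP.
have [l [ex2 pm so]] := exec_sort_goods [::] (rev (emb w)) (bits x) (nseq (size l0) (Tag
    true)) le1 (isT : sorted richer [::]) nil_ok.
rewrite cats0 in pm.
have szw : size (word l) = size (word l1).
  by rewrite /word !size_flatten /shape; apply: perm_sumn; do 2!apply: perm_map.
set n := minn (numval x) (size l0).
pose lf := iter n (@swap_ends _) l.
have szf : size (word lf) = size (word l).
  by rewrite /lf; elim: (n) => //= m IH; rewrite size_word_swap.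
have le3 : size (word l) + size x <= size w by move: sz sz1 szw; size_nia.
have ex3 := exec_swaps [::] (rev (emb w)) (nseq (size l0) (Tag true)) le3.
rewrite size_nseq -/n -/lf in ex3.
have ex4 := exec_drop_richest [::] (rev (emb w)) lf.
have szd : size (word (drop_first lf)) <= size (word lf).
  elim: (lf) => // g m IH; rewrite [drop_first _]/=; case: ifP => _; rewrite !size_word_cons;
      move: IH; size_nia.
have le5 : size (word (drop_first lf)) + size (@nil (bool * bool)) <= size w.
  by rewrite addn0; move: sz sz1 szw szf szd; size_nia.
have [a [ex5 sza tot]] := exec_sum_goods [::] (rev (emb w)) le5.
have ex6 := exec_compare_sums [::] (rev (emb w)) a.
rewrite !tot /side /= !addn0 in ex6.
exists (x, l0), l, (greedy_ok n l); eexists; split; [exact: wf | exact: ew | | by [] | split].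
- by split=> //; apply: perm_trans pm _; rewrite /l1 perm_rev.
- apply: exec_le (exec_seq ex1 (exec_seq ex2 (exec_seq ex3 (exec_seq ex4 (exec_seq ex5 ex6))))).
  rewrite !expnS expn0.
  have le7 : size a <= size w by move: sza le5; size_nia.
  have le8 : size (drop_first lf) <= size w.
    by have := size_word_ge (drop_first lf); move: le5; size_nia.
  have le9 : size (word lf) <= size w by move: le3; rewrite szf; size_nia.
  have le10 : size l1 <= size w by move: szl le1; size_nia.
  have le11 : size l0 <= size w by rewrite -szl1.
  move: le7 le8 le9 le10 le11; size_nia.
- by rewrite /greedy_ok -/lf => ->.
Qed.

End Parsing.

(** * Greedy exchanges *)

Section Greedy.
Variables (T : finType) (v : T -> nat).
Implicit Types (X B : {set T}) (g h : T).

Definition worth X := \sum_(g in X) v g.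

(* The owner of [X] is EF1 towards the owner of the other goods. *)
Definition content X :=
  (~: X == set0) || [exists h, (h \notin X) && (worth (~: X) <= worth X + v h)].

Definition trade X g h := h |: (X :\ g).

Definition traded X B := exists g h, [/\ g \in X, h \notin X & B = trade X g h].

Lemma worthU1 X h : h \notin X -> worth (h |: X) = v h + worth X.
Proof. exact: big_setU1. Qed.

Lemma worthD1 X g : g \in X -> worth X = v g + worth (X :\ g).
Proof. exact: big_setD1. Qed.

Lemma tradeC X g h : g \in X -> h \notin X -> ~: trade X g h = trade (~: X) h g.
Proof.
move=> gX hX; have hg : (h == g) = false by apply/negbTE; apply: contraNneq hX => ->.
apply/setP => x; rewrite !inE; case: (eqVneq x h) => [->|_] /=; first by rewrite hg.
by case: (eqVneq x g) => [->|_].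
Qed.

Lemma worth_trade X g h : g \in X -> h \notin X -> worth (trade X g h) + v g = worth X + v h.
Proof.
move=> gX hX; rewrite worthU1 ?(worthD1 gX); first lia.
by rewrite inE (negbTE hX) andbF.
Qed.

Lemma card_trade X g h : g \in X -> h \notin X -> #|trade X g h| = #|X|.
Proof.
by move=> gX hX; rewrite cardsU1 (cardsD1 g X) gX inE (negbTE hX) andbF.
Qed.

Lemma contentP X h : h \notin X -> (forall y, y \notin X -> v y <= v h) ->
  content X = (worth (~: X) <= worth X + v h).
Proof.
move=> hX hmax; rewrite /content.
have -> : (~: X == set0) = false by apply/negbTE/set0Pn; exists h; rewrite inE.
apply/existsP/idP => [[y /andP[yX le_y]]|le_h]; last by exists h; rewrite hX.
by have := hmax y yX; lia.
Qed.

(* Trading for a good worth at least as much keeps the owner content: if the good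
   received was the one to be disregarded, disregard the good given instead. *)
Lemma content_trade X g h : g \in X -> h \notin X -> v g <= v h ->
  content X -> content (trade X g h).
Proof.
move=> gX hX le_gh /orP[/eqP X0|/existsP[y /andP[yX le_y]]].
  by have := in_set0 h; rewrite -X0 inE hX.
have w1 := worth_trade gX hX.
have w2 : worth (~: trade X g h) + v h = worth (~: X) + v g.
  by rewrite tradeC // worth_trade ?inE ?gX.
have ghne : g != h by apply: contraNneq hX => <-.
apply/orP; right; apply/existsP.
have [eq_yh|ne_yh] := eqVneq y h.
  exists g; rewrite !inE eqxx (negbTE ghne) /=; rewrite eq_yh in le_y; lia.
exists y; rewrite !inE negb_or ne_yh negb_and yX orbT /=; lia.
Qed.

(** The other agent disregards [h], which it has just given away: what is left is [X :\ g], while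
    the owner of [X] envied the other agent even with [h] disregarded. *)
Lemma envied_content X g h : g \in X -> h \notin X -> ~~ content X ->
  content (~: trade X g h).
Proof.
move=> gX hX /norP[_ /existsPn /(_ h)]; rewrite hX -ltnNge /= => lt_h.
have w1 := worth_trade gX hX.
have w2 : worth (~: trade X g h) + v h = worth (~: X) + v g.
  by rewrite tradeC // worth_trade ?inE ?gX.
apply/orP; right; apply/existsP; exists h; rewrite setCK !inE eqxx /=; lia.
Qed.

(** The first alternative is the swap that returns the good just received; it is allowed only if [X]
    is already the best bundle of its size. *)
Definition greedy_step X B :=
  (B = X /\ forall x y, x \in X -> y \notin X -> v y <= v x) \/
  exists g h, [/\ g \in X, h \notin X & B = trade X g h] /\
    [/\ forall x, x \in X -> v g <= v x, forall y, y \notin X -> v y <= v h & v g <= v h].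

Variable s : {set T} -> {set T}.
Hypothesis greedy : forall X, greedy_step X (s X).

Lemma content_step X : content X -> content (s X).
Proof.
move=> cX; case: (greedy X) => [[-> _] //|[g [h [[gX hX ->] [_ _ le_gh]]]]].
exact: content_trade.
Qed.

Lemma proper_diff X B : #|B| = #|X| -> X != B ->
  exists a b, [/\ a \in X, a \notin B, b \in B & b \notin X].
Proof.
move=> cardB ne.
have [a aX aB] : exists2 a, a \in X & a \notin B.
  by apply/subsetPn; apply: contra ne => sub; rewrite eqEcard sub cardB /=.
have [b bB bX] : exists2 b, b \in B & b \notin X.
  by apply/subsetPn; apply: contra ne => sub; rewrite eq_sym eqEcard sub cardB /=.
by exists a, b.
Qed.

Lemma diff_trade X B b a : a \in X -> a \notin B -> b \in B -> b \notin X ->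
  #|X :\: trade B b a| < #|X :\: B|.
Proof.
move=> aX aB bB bX; rewrite [X in _ < X](cardsD1 a) !inE aX aB /=.
rewrite ltnS; apply: subset_leq_card; apply/subsetP => x; rewrite !inE.
by have [->|xa] := eqVneq x a; rewrite //= negb_and negbK; case: eqVneq => [->|_] //=;
    rewrite (negbTE bX) andbF.
Qed.

(** Exchange argument: [B] undergoes trades that keep its owner content until it omits the good
    given by the greedy trade and contains the good received. *)
Lemma greedy_progress X B n : #|B| = #|X| -> content B -> #|X :\: B| <= n.+1 ->
  exists B', [/\ #|B'| = #|s X|, content B' & #|s X :\: B'| <= n].
Proof.
move=> cardB cB le_n; have [eXB|ne] := eqVneq X B.
  by exists (s X); rewrite setDv cards0; split=> //; apply: content_step; rewrite eXB.
have [a [b [aX aB bB bX]]] := proper_diff cardB ne.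
case: (greedy X) => [[-> best]|[g [h [[gX hX ->] [gmin hmax le_gh]]]]].
  (* As [X] is already the best bundle of its size, moving [B] one good closer to it cannot hurt. *)
  exists (trade B b a); split; first by rewrite card_trade.
    by apply: content_trade => //; apply: best.
  by rewrite -ltnS; apply: leq_trans le_n; apply: diff_trade.
(* If [g] is in [B], it is traded for [a], which is worth at least as much because [g] is a least
   valuable good of [X]. The distance to [X] does not grow. *)
have [B1 [card1 c1 gB1 [bB1 d1]]] : exists B1, [/\ #|B1| = #|X|, content B1, g \notin B1 &
    b \in B1 /\ #|X :\: B1| <= n.+1].
  have [gB|gB] := boolP (g \in B); last by exists B.
  have ne_gb : b != g by apply: contraNneq bX => ->.
  exists (trade B g a); split.
  - by rewrite card_trade.
  - by apply: content_trade => //; apply: gmin.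
  - by rewrite !inE eqxx orbF; apply: contraNneq aB => <-.
  - split; first by rewrite !inE ne_gb bB orbT.
    apply: leq_trans le_n; rewrite [X in _ <= X](cardsD1 a) !inE aX aB /=.
    apply: leq_trans (_ : #|g |: (X :\: B) :\ a| <= _);
        last by rewrite cardsU1 leq_add2r leq_b1.
    apply: subset_leq_card; apply/subsetP => x; rewrite !inE.
    by case: (x == g); case: (x == a); case: (x \in B).
(* If [h] is missing, it replaces [b]: both lie outside [X], where [h] has the greatest value. *)
have [B2 [card2 c2 gB2 [hB2 d2]]] : exists B2, [/\ #|B2| = #|X|, content B2, g \notin B2 &
    h \in B2 /\ #|X :\: B2| <= n.+1].
  have [hB|hB] := boolP (h \in B1); first by exists B1.
  exists (trade B1 b h); split.
  - by rewrite card_trade.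
  - by apply: content_trade => //; apply: hmax.
  - by rewrite !inE (negbTE gB1) andbF orbF; apply: contraNneq hX => <-.
  - split; first by rewrite !inE eqxx.
    apply: leq_trans d1; apply: subset_leq_card; apply/subsetP => x; rewrite !inE.
    by case: eqVneq => [->|_] //=; case: eqVneq => [->|_] //=; rewrite (negbTE bX) andbF.
exists B2; split=> //; first by rewrite card_trade.
(* Replacing [g] by [h] in [X] removes [g] from the difference and adds nothing, since [h] is in
   [B2]. *)
rewrite -ltnS; apply: leq_trans d2; apply: proper_card; apply/properP; split.
  apply/subsetP => x; rewrite !inE; case: eqVneq => [->|_] //=; first by rewrite hB2.
  by case/and3P => -> _ ->.
by exists g; rewrite !inE ?gB2 ?gX // eqxx orbF andTb; apply: contraNneq hX => <-.
Qed.

Lemma greedy_optimal n X B : #|B| = #|X| -> content B -> #|X :\: B| <= n ->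
  content (iter n s X).
Proof.
elim: n X B => [|n IH] X B cardB cB.
  rewrite leqn0 cards_eq0 setD_eq0 => sub.
  suff -> : iter 0 s X = B by [].
  by apply/eqP; rewrite eqEcard sub cardB /=.
case/(greedy_progress cardB cB) => B' [card' c' d'].
by rewrite iterSr; apply: IH card' c' d'.
Qed.

Fixpoint trades n X B := if n is n'.+1 then exists2 C, traded X C & trades n' C B else X = B.

Lemma trades_rcons n X C B : trades n X C -> traded C B -> trades n.+1 X B.
Proof.
elim: n X => [|n IH] X /=; first by move=> -> tr; exists B.
by case=> D tr trs /(IH _ trs) ?; exists D.
Qed.

Lemma trades_card n X B : trades n X B -> #|B| = #|X| /\ #|X :\: B| <= n.
Proof.
elim: n X => [|n IH] X /=; first by move=> ->; rewrite setDv cards0.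
case=> C [g [h [gX hX ->]]] /IH [card1 d1]; rewrite card1 card_trade //; split=> //.
rewrite (cardsD1 g) -add1n; apply: leq_add; first exact: leq_b1.
apply: leq_trans d1; apply: subset_leq_card; apply/subsetP => x; rewrite !inE.
by case/and3P=> -> -> ->; rewrite orbT.
Qed.

(* At the first moment when the greedy trades make the owner of [X] content, the
   other agent, who was envied until then, is content too. *)
Lemma greedy_trades n X : ~~ content X -> content (iter n s X) ->
  exists2 j, j <= n & exists2 B, trades j X B & content B && content (~: B).
Proof.
move=> ncX cn.
have [|j cj jmin] := @ex_minnP (fun j => content (iter j s X)); first by exists n.
exists j; first exact: jmin.
case: j cj jmin => [|j] cj jmin; first by rewrite (negbTE ncX) in cj.
have nc i : i <= j -> ~~ content (iter i s X) by move=> le; apply: contraL le => /jmin; lia.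
have tr i : i <= j -> traded (iter i s X) (iter i.+1 s X).
  move=> le_ij; rewrite iterS; case: (greedy (iter i s X)) => [[es _]|[g [h [? _]]]];
      last by exists g, h.
  (* A step that changes nothing would repeat forever, and the agent would never become content;
     hence every step before that moment is a genuine trade. *)
  have fixed k : iter (k + i) s X = iter i s X.
    by elim: k => //= k ->.
  by move: cj; rewrite -[j](subnK le_ij) -addSn fixed (negbTE (nc i le_ij)).
exists (iter j.+1 s X).
  elim: {cj jmin nc} j tr => [|j IH] tr; first by exists (s X); [apply: (tr 0)|].
  apply: trades_rcons (tr j.+1 _) => //; apply: IH => i le_ij; apply: tr; lia.
rewrite cj; have [g [h [gX hX E]]] := tr j (leqnn _).
by rewrite E; apply: envied_content => //; apply: nc.
Qed.

End Greedy.

(** * Sorted lists of goods as bundles *)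

Section Relabel.
Variables (T U : Type) (f : T -> U).

(** The program handles numerals, the argument on bundles names of goods. Swaps look only at roles
    and so commute with the passage from names to numerals. *)
Definition relabel (p : bool * T) : bool * U := (p.1, f p.2).

Lemma flip_map e s : flip e (map relabel s) = map relabel (flip e s).
Proof. by elim: s => // p s IH; rewrite /= IH; case: ifP; rewrite /of_role /= => ->. Qed.

Lemma swap_ends_map s : swap_ends (map relabel s) = map relabel (swap_ends s).
Proof.
rewrite /swap_ends has_map (@eq_has _ _ (of_role true)) //; case: ifP => // _.
by rewrite flip_map -map_rev flip_map map_rev.
Qed.

Lemma iter_swap_ends_map n s :
  iter n (@swap_ends U) (map relabel s) = map relabel (iter n (@swap_ends T) s).
Proof. by elim: n => //= n ->; apply: swap_ends_map. Qed.

Lemma drop_first_map s : drop_first (map relabel s) = map relabel (drop_first s).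
Proof. by elim: s => // p s IH; rewrite /= IH; case: ifP; rewrite /of_role /= => ->. Qed.

End Relabel.

Section Tagged.
Variables (T : finType) (v : T -> nat) (ord : seq T).
Hypotheses (uniq_ord : uniq ord) (ord_full : forall g, g \in ord)
  (ord_sorted : sorted (fun g h => v h <= v g) ord).
Implicit Types (X B : {set T}) (g h : T).

Definition tagged X s : seq (bool * T) := [seq (g \notin X, g) | g <- s].

Lemma snd_tagged X s : map snd (tagged X s) = s.
Proof. by rewrite -map_comp map_id. Qed.

Lemma tagged_split X s1 p s2 : tagged X ord = s1 ++ p :: s2 ->
  [/\ ord = map snd s1 ++ p.2 :: map snd s2, s1 = tagged X (map snd s1),
      p.1 = (p.2 \notin X) & s2 = tagged X (map snd s2)].
Proof.
move=> eX; have eord : ord = map snd s1 ++ p.2 :: map snd s2.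
  by rewrite -(snd_tagged X ord) eX map_cat.
move: eX; rewrite [in X in tagged _ X]eord /tagged map_cat /=.
move/eqP; rewrite eqseq_cat ?size_map // eqseq_cons => /and3P[/eqP <- /eqP ep /eqP <-].
by rewrite !snd_tagged; split=> //; rewrite -ep.
Qed.

Lemma tagged_update X B s1 p s2 : tagged X ord = s1 ++ p :: s2 ->
  (forall y, y != p.2 -> (y \in B) = (y \in X)) ->
  tagged B ord = s1 ++ (p.2 \notin B, p.2) :: s2.
Proof.
move/tagged_split => [eord e1 _ e2] same.
have := uniq_ord; rewrite eord uniq_catC /= mem_cat negb_or => /andP[/andP[n2 n1] _].
have eqt s : p.2 \notin s -> tagged B s = tagged X s.
  by move=> ns; apply/eq_in_map => y ys; rewrite same //; apply: contraNneq ns => <-.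
by rewrite {1}/tagged map_cat /= -!/(tagged _ _) !eqt // -e1 -e2.
Qed.

Lemma ord_split s1 x s2 : ord = s1 ++ x :: s2 ->
  (forall y, y \in s1 -> v x <= v y) /\ (forall y, y \in s2 -> v y <= v x).
Proof.
move=> eord; move: ord_sorted; rewrite sorted_pairwise; last by move=> y x' z /=; lia.
rewrite eord pairwise_cat /= => /and3P[/allrelP al _ /andP[/allP p2 _]]; split=> y ys.
  by apply: al; rewrite ?mem_head.
exact: p2.
Qed.

(** The order of the list never changes, so the tags alone record a bundle, and a swap of the list
    induces a map on bundles. *)
Definition swap_step X := [set g | (false, g) \in swap_ends (tagged X ord)].

Lemma mem_tagged X g s : ((g \notin X, g) \in tagged X s) = (g \in s).
Proof. by apply/mapP/idP => [[y ys [_ ->]]|gs] //; exists g. Qed.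

Lemma tagged_no_role e X s g : ~~ has (of_role e) (tagged X s) -> g \in s -> (g \notin X) = ~~
    e.
Proof.
move/hasPn => no gs; have := no (g \notin X, g); rewrite mem_tagged => /(_ gs).
by rewrite /of_role /=; case: (g \in X); case: e {no}.
Qed.

Lemma tagged_swap X B : swap_ends (tagged X ord) = tagged B ord -> swap_step X = B.
Proof.
move=> E; apply/setP => g; rewrite inE E; apply/mapP/idP => [[y _ [e ->]]|gB].
  by rewrite -[_ \in _]negbK -e.
by exists g; rewrite ?gB.
Qed.

Lemma swap_stepP X :
  swap_ends (tagged X ord) = tagged (swap_step X) ord /\ greedy_step v X (swap_step X).
Proof.
suff [B eB stB] : exists2 B, swap_ends (tagged X ord) = tagged B ord & greedy_step v X B.
  by rewrite (tagged_swap eB).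
have [hX|hX] := boolP (has (of_role true) (tagged X ord)); last first.
  exists X; first by rewrite /swap_ends (negbTE hX).
  left; split=> // x y _ yX; have := tagged_no_role hX (ord_full y).
  by rewrite yX.
have [s1 [h [s2 [s3 [g [s4 [eX no1 e34 no4 ->]]]]]]] := swap_endsP hX.
have [o1 t1 /= /esym hnX t2] := tagged_split eX.
(* The intermediate state: the favoured agent holds one good more than before. *)
have e1 : tagged (h |: X) ord = s1 ++ (false, h) :: s2.
  have := @tagged_update X (h |: X) _ _ _ eX; rewrite /= setU11; apply=> y yh.
  by rewrite !inE (negbTE yh).
rewrite e34 in e1.
have [o3 t3 /= /esym gX t4] := tagged_split e1.
have e2 : tagged ((h |: X) :\ g) ord = s3 ++ (true, g) :: s4.
  have := @tagged_update (h |: X) ((h |: X) :\ g) _ _ _ e1; rewrite /= setD11; apply=> y yg.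
  by rewrite !inE yg.
have [le1 ge1] := ord_split o1; have [le3 ge3] := ord_split o3.
have hmax y : y \notin X -> v y <= v h.
  move=> yX; have := ord_full y; rewrite o1 mem_cat inE => /or3P[y1|/eqP ->|/ge1] //.
  by rewrite t1 in no1; have := tagged_no_role no1 y1; rewrite yX.
have gmin x : x \in X -> v g <= v x.
  move=> xX; have := ord_full x; rewrite o3 mem_cat inE => /or3P[/le3|/eqP ->|x4] //.
  by rewrite t4 in no4; have := tagged_no_role no4 x4; rewrite !inE xX orbT.
(* If the received good is given back, every good outside [X] is worth at most [v h], and every good
   of [X] at least [v g], the same number. *)
have [gh|ngh] := eqVneq g h.
  exists X; first by rewrite -e2 gh setU1K //.
  left; split=> // x y xX yX; apply: leq_trans (hmax y yX) _; rewrite -gh; exact: gmin.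
exists ((h |: X) :\ g) => //; right; exists g, h.
have {}gX : g \in X by move: gX; rewrite !inE (negbTE ngh) => /negbFE.
split; split=> //.
  by apply/setP => x; rewrite !inE; case: eqVneq => [->|_] /=; rewrite ?(negbTE ngh) //;
      case: eqVneq.
(* The favoured agent has no good behind [g], so [h] stands before [g] and is worth at least as
   much. *)
have := ord_full h; rewrite o3 mem_cat inE eq_sym (negbTE ngh) => /or3P[/le3||x4] //.
by rewrite t4 in no4; have := tagged_no_role no4 x4; rewrite !inE eqxx.
Qed.

Lemma iter_swap_tagged n X :
  iter n (@swap_ends T) (tagged X ord) = tagged (iter n swap_step X) ord.
Proof. by elim: n => //= n ->; case: (swap_stepP (iter n swap_step X)). Qed.

Definition role_worth e (s : seq (bool * T)) := \sum_(p <- s | of_role e p) v p.2.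

Lemma worth_ord X : worth v X = \sum_(g <- ord | g \in X) v g.
Proof.
apply/esym/perm_big/uniq_perm => //; first exact: index_enum_uniq.
by move=> g; rewrite mem_index_enum ord_full.
Qed.

Lemma role_worth_tagged e X : role_worth e (tagged X ord) = worth v (if e then ~: X else X).
Proof.
rewrite /role_worth big_map worth_ord; apply: eq_bigl => g.
by rewrite /of_role /=; case: e; rewrite ?inE; case: (g \in X).
Qed.

(** The first good of the other agent is its most valuable one and thus the best to disregard. If it
    has none, [drop_first] does nothing and the compared sum is 0. *)
Lemma content_tagged X :
  content v X = (role_worth true (drop_first (tagged X ord)) <=
                 role_worth false (drop_first (tagged X ord))).
Proof.
have [hX|hX] := boolP (has (of_role true) (tagged X ord)); last first.
  rewrite drop_first_id // !role_worth_tagged.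
  have X0 : ~: X = set0.
    apply/setP => y; rewrite !inE; apply/negbTE/negPn.
    by have := tagged_no_role hX (ord_full y); rewrite /= => /negbFE.
  by rewrite X0 /content X0 eqxx /= /worth big_set0.
have [s1 [h [s2 [eX no1 ->]]]] := drop_firstP hX.
have [o1 t1 /= /esym hnX t2] := tagged_split eX.
have [le1 ge1] := ord_split o1.
rewrite (@contentP _ _ _ h) // => [|y yX].
  have := role_worth_tagged true X; have := role_worth_tagged false X.
  rewrite eX /role_worth !big_cat !big_cons /= => <- <-.
  by rewrite [X in X <= _]addnCA addnC leq_add2r.
have := ord_full y; rewrite o1 mem_cat inE => /or3P[y1|/eqP ->|/ge1] //.
by rewrite t1 in no1; have := tagged_no_role no1 y1; rewrite yX.
Qed.

End Tagged.

(** * Instances and their encodings *)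

Section Reach.
Variables (T : finType) (v : T -> nat).
Implicit Types (X B : {set T}).

Lemma tradesC n X B : trades n X B -> trades n (~: X) (~: B).
Proof.
elim: n X => [|n IH] X /=; first by move=> ->.
case=> C [g [h [gX hX ->]]] /IH tr; exists (~: trade X g h) => //.
by exists h, g; rewrite tradeC // !inE gX hX.
Qed.

Lemma greedy_reaches s1 s2 k X :
  (forall X, greedy_step v X (s1 X)) -> (forall X, greedy_step v X (s2 X)) ->
  let n := minn k #|T| in
  reflect (exists2 j, j <= k & exists2 B, trades j X B & content v B && content v (~: B))
    (content v (iter n s1 X) && content v (iter n s2 (~: X))).
Proof.
move=> gr1 gr2 n; apply: (iffP andP) => [[c1 c2]|[j le_j [B tr /andP[cB cB']]]].
  have le_n : n <= k by apply: geq_minl.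
  have [cX|ncX] := boolP (content v X); last first.
    have [j le_j [B tr cB]] := greedy_trades gr1 ncX c1.
    by exists j; [apply: leq_trans le_n | exists B].
  have [cX'|ncX'] := boolP (content v (~: X)).
    by exists 0 => //; exists X; rewrite ?cX.
  have [j le_j [B /tradesC]] := greedy_trades gr2 ncX' c2; rewrite setCK => tr cB.
  by exists j; [apply: leq_trans le_n | exists (~: B); rewrite // setCK andbC].
(* The target differs from the start in at most [j] goods and in at most all goods, hence in at most
   [n]. *)
have opt s Y D : (forall X, greedy_step v X (s X)) -> trades j Y D -> content v D ->
    content v (iter n s Y).
  move=> gr /trades_card[cardD dD] cD; apply: (greedy_optimal gr cardD cD).
  by rewrite leq_min max_card (leq_trans dD).
by split; [apply: opt gr1 tr cB | apply: opt gr2 (tradesC tr) cB'].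
Qed.

End Reach.

(** The sort acts on pairs of tag and numeral; this recovers an order of the goods themselves that
    induces the sorted list. *)
Lemma perm_map_lift (T U : eqType) (f : T -> U) l s :
  perm_eq l (map f s) -> exists2 s', perm_eq s' s & l = map f s'.
Proof.
elim: l s => [|x l IH] s pm.
  by exists [::] => //; case: s pm => //= y s /perm_size.
have /mapP[y ys ex] : x \in map f s by rewrite -(perm_mem pm) mem_head.
have [|s' pm' el] := IH (rem y s).
  by rewrite -(perm_cons x) (perm_trans pm) // ex -map_cons perm_map // perm_to_rem.
exists (y :: s'); last by rewrite /= ex el.
by rewrite perm_sym (perm_trans (perm_to_rem ys)) // perm_cons perm_sym.
Qed.

Lemma greedy_ok_content (T : finType) (own : T -> bool) (x : T -> seq bool) (v : T -> nat) l :
  (forall g, numval (x g) = v g) ->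
  perm_eq l [seq (own g, x g) | g <- enum T] -> sorted richer l ->
  exists2 s, (forall X : {set T}, greedy_step v X (s X)) &
    forall n X, X = [set g | ~~ own g] -> greedy_ok n l = content v (iter n s X).
Proof.
move=> ev pm so.
have [ord pm' el] := perm_map_lift pm.
have uo : uniq ord by rewrite (perm_uniq pm') enum_uniq.
have fo g : g \in ord by rewrite (perm_mem pm') mem_enum.
have sv : sorted (fun g h => v h <= v g) ord.
  by move: so; rewrite el sorted_map; apply: sub_sorted => g h; rewrite /relpre /richer /= !ev.
exists (swap_step ord) => [Y|n X eX]; first by case: (swap_stepP uo fo sv Y).
have el' : l = map (relabel x) (tagged X ord).
  by rewrite el eX /tagged -map_comp; apply: eq_map => g; rewrite /= inE negbK.
rewrite (content_tagged uo fo sv) -(iter_swap_tagged uo fo sv) /greedy_ok.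
rewrite el' iter_swap_ends_map drop_first_map.
have tot e s : total e (map (relabel x) s) = role_worth v e s.
  by rewrite /total big_map; apply: eq_bigr => p _; apply: ev.
by rewrite !tot.
Qed.

(** * Canonical binary numerals *)

Definition binary (n : nat) : seq bool :=
  if bin_of_nat n is Npos p then positive_bits p else [::].

Lemma numeralE n : numeral n = letters (binary n).
Proof. by rewrite /numeral /binary; case: bin_of_nat. Qed.

Lemma canonical_positive p : canonical (positive_bits p).
Proof.
suff: forall e, last e (positive_bits p) by apply.
by elim: p => //= p IH e; apply: IH.
Qed.

Lemma canonical_binary n : canonical (binary n).
Proof. by rewrite /binary; case: bin_of_nat => // p; apply: canonical_positive. Qed.

Lemma numval_positive p : numval (positive_bits p) = nat_of_pos p.
Proof. by elim: p => //= p ->; rewrite NatTrec.doubleE. Qed.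

Lemma numval_binary n : numval (binary n) = n.
Proof.
rewrite -[RHS]bin_of_natK /binary; case: (bin_of_nat n) => //= p.
exact: numval_positive.
Qed.

Lemma canonical_bits x : canonical x -> x = [::] \/ exists p, x = positive_bits p.
Proof.
elim: x => [|e x IH]; first by left.
case: x IH => [|e' x] IH cx; right; first by exists xH; rewrite [e]cx.
by have [//|[p ->]] := IH cx; case: e cx => _; [exists (xI p) | exists (xO p)].
Qed.

Lemma binary_numval x : canonical x -> binary (numval x) = x.
Proof.
case/canonical_bits => [->|[p ->]] //.
by rewrite numval_positive /binary -[nat_of_pos p]/(nat_of_bin (Npos p)) nat_of_binK.
Qed.

(** * Allocations between two agents as single bundles *)

Section TwoAgents.
Variable m : nat.
Implicit Types (A B : allocation 2 m).

Definition first_bundle A := bundle A ord0.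

Lemma ord2P (i : 'I_2) : i = ord0 \/ i = ord_max.
Proof. by case: i => [[|[|]]] // lt; [left | right]; apply: val_inj. Qed.

Lemma second_bundle A : bundle A ord_max = ~: first_bundle A.
Proof. by apply/setP => g; rewrite !inE; case: (ord2P (A g)) => ->. Qed.

Lemma trade_setU (X : {set 'I_m}) g h : g \in X -> h \notin X -> (X :|: [set h]) :\ g = trade
    X g h.
Proof.
move=> gX hX; apply/setP => y; rewrite !inE.
by case: (eqVneq y h) => [->|_]; rewrite ?orbF // orbT andbT; apply: contraNneq hX => ->.
Qed.

Lemma exchange_traded A B : exchange A B -> traded (first_bundle A) (first_bundle B).
Proof.
case=> i [j [g [g' [[ne gA g'A] [eBi eBj _]]]]].
case: (ord2P i) (ord2P j) ne gA g'A eBi eBj => -> [] -> // _.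
  rewrite second_bundle in_setC => gA g'A eB _; exists g, g'; split=> //.
  exact: etrans eB (trade_setU gA g'A).
rewrite second_bundle in_setC => gA g'A _ eB; exists g', g; split=> //.
exact: etrans eB (trade_setU g'A gA).
Qed.

Lemma traded_exchange A X : traded (first_bundle A) X ->
  exists2 B, exchange A B & first_bundle B = X.
Proof.
case=> g [h [gA hA eX]];
    pose B : allocation 2 m := [ffun y => if y \in X then ord0 else ord_max].
have eB : first_bundle B = X by apply/setP => y; rewrite !inE ffunE; case: ifP.
exists B => //; exists ord0, ord_max, g, h; split; split=> //.
- by rewrite second_bundle inE.
- by rewrite [LHS]eB [RHS](trade_setU gA hA).
- by rewrite !second_bundle eB eX tradeC // trade_setU // in_setC ?negbK.
- by move=> k; case: (ord2P k) => ->.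
Qed.

Lemma exchanges_trades n A B : exchanges n A B -> trades n (first_bundle A) (first_bundle B).
Proof.
elim: n A => [|n IH] A /=; first by move=> ->.
by case=> C /exchange_traded tr /IH; exists (first_bundle C).
Qed.

Lemma trades_exchanges n A X : trades n (first_bundle A) X ->
  exists2 B, exchanges n A B & first_bundle B = X.
Proof.
elim: n A => [|n IH] A /=; first by exists A.
case=> C /traded_exchange[D ex <-] /IH[B exs eB].
by exists B => //; exists D.
Qed.

Variable u : 'I_2 -> 'I_m -> nat.
Hypothesis identical : forall i j g, u i g = u j g.

Lemma EF1_content A i j : i != j -> EF1_towards u A i j <-> content (u ord0) (bundle A i).
Proof.
move=> ne; have eC : bundle A j = ~: bundle A i.
  by case: (ord2P i) (ord2P j) ne => -> [] -> // _; rewrite second_bundle ?setCK.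
have util k Y : utility u k Y = worth (u ord0) Y by apply: eq_bigr => g _; apply: identical.
have split_worth h : h \notin bundle A i ->
    (worth (u ord0) (~: bundle A i) <= worth (u ord0) (bundle A i) + u ord0 h) =
    (utility u i (~: bundle A i :\ h) <= utility u i (bundle A i)).
  by move=> hA; rewrite !util (@worthD1 _ _ (~: _) h) ?in_setC // addnC leq_add2r.
rewrite /EF1_towards /content eC; split.
  case=> [->|[h]]; first by rewrite eqxx.
  rewrite in_setC => hA; rewrite -split_worth // => le_h.
  by apply/orP; right; apply/existsP; exists h; rewrite hA.
case/orP => [/eqP|/existsP[h /andP[hA le_h]]]; [by left | right; exists h].
  by rewrite in_setC.
by rewrite -split_worth.
Qed.

Lemma EF1P A : EF1 u A <->
  content (u ord0) (first_bundle A) && content (u ord0) (~: first_bundle A).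
Proof.
split=> [ef|/andP[c0 c1] i j].
  apply/andP; split; first by apply/(@EF1_content A ord0 ord_max) => //; apply: ef.
  by rewrite -second_bundle; apply/(@EF1_content A ord_max ord0) => //; apply: ef.
case: (ord2P i) (ord2P j) => -> [] -> // _; apply/EF1_content => //.
by rewrite second_bundle.
Qed.

Lemma reaches_trades A n : reaches_EF1 u A n <->
  exists2 B, trades n (first_bundle A) B & content (u ord0) B && content (u ord0) (~: B).
Proof.
split=> [[B /exchanges_trades tr /EF1P cB]|[X /trades_exchanges[B ex <-] cB]].
  by exists (first_bundle B).
by exists B => //; apply/EF1P.
Qed.

(** If a budget passes the test, there is a least such [k0]. It yields some [n <= k0] that reaches
    EF1, and every [n'] that does so passes as a budget, whence [k0 <= n'] and [n] is optimal. *)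
Lemma optimal_reachable A s1 s2 k :
  (forall X, greedy_step (u ord0) X (s1 X)) -> (forall X, greedy_step (u ord0) X (s2 X)) ->
  (exists2 n, optimal_number u A n & n <= k) <->
  let n := minn k m in
  content (u ord0) (iter n s1 (first_bundle A)) && content (u ord0) (iter n s2 (~:
      first_bundle A)).
Proof.
move=> gr1 gr2; have dec k' := greedy_reaches k' (first_bundle A) gr1 gr2.
rewrite card_ord /= in dec; split=> [[n [re _] le_n]|].
  by apply/dec; exists n => //; apply/reaches_trades.
move=> ok; pose P k' := content (u ord0) (iter (minn k' m) s1 (first_bundle A)) &&
  content (u ord0) (iter (minn k' m) s2 (~: first_bundle A)).
have [|k0 /dec[n le_n /reaches_trades re] kmin] := @ex_minnP P; first by exists k.
exists n; last by apply: leq_trans le_n _; apply: kmin.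
split=> // n' /reaches_trades re'; apply: leq_trans le_n _; apply: kmin.
by apply/dec; exists n'.
Qed.

End TwoAgents.

(** * Instances, their codes and the final bound *)

Lemma goods_code_inj l l' : goods_code l = goods_code l' -> l = l'.
Proof.
elim: l l' => [|[e x] l IH] [|[e' x'] l'] //.
- by rewrite /goods_code /= good_code_cat; case: e'.
- by rewrite /goods_code /= good_code_cat; case: e.
rewrite /goods_code /= !good_code_cat => /numeral_uniq[ee _].
by case/numeral_uniq => /= -> _ /numeral_uniq[_ _ /IH ->]; case: e e' ee => [] [].
Qed.

Lemma code_inj d d' : code d = code d' -> d = d'.
Proof. by case: d d' => [x l] [x' l'] /numeral_uniq[/= -> _ /goods_code_inj ->]. Qed.

Definition restricted (I : oe_instance) := two_agents I /\ identical_utilities I.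

Lemma encode_good_code m (k : nat) hn hm (u : 'I_2 -> 'I_m -> nat) (A : allocation 2 m) g :
  (forall i j g, u i g = u j g) ->
  @encode_good (@OEInstance 2 m hn hm u A k) g = good_code (A g == ord_max, binary (u ord0 g)).
Proof.
move=> id_u; rewrite /encode_good /good_code !numeralE /=.
have -> : enum 'I_2 = [:: ord0; ord_max].
  by apply: (inj_map val_inj); rewrite val_enum_ord.
rewrite /= cats0 !numeralE (id_u ord_max ord0) -!catA !cat_cons -?catA.
by congr (_ ++ _); case: (ord2P (A g)) => ->.
Qed.

Lemma map_assign (T : Type) role (own : T -> bool) (x : T -> seq bool) s :
  map (assign role) [seq (own g, x g) | g <- s] = [seq (own g (+) role, x g) | g <- s].
Proof. by rewrite -map_comp. Qed.

(** The lists are arbitrary sorted permutations, since this is all that is known about the output of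
    the sort. *)
Lemma restricted_code I : restricted I -> exists d,
  [/\ well_formed d, encode I = code d &
    forall l0 l1,
      perm_eq l0 (map (assign false) d.2) -> sorted richer l0 ->
      perm_eq l1 (map (assign true) d.2) -> sorted richer l1 ->
      let n := minn (numval d.1) (size d.2) in
      greedy_ok n l0 && greedy_ok n l1 <-> optimal_exchanges I].
Proof.
case: I => n m hn hm u A k [] /= e id_u; rewrite /two_agents /= in e; subst n.
rewrite /identical_utilities /= in id_u.
exists (binary k, [seq (A g == ord_max, binary (u ord0 g)) | g <- enum 'I_m]); split=> /=.
- rewrite /well_formed /= canonical_binary -size_eq0 size_map size_enum_ord -lt0n hm.
  by apply/allP => g /mapP[y _ ->]; apply: canonical_binary.
- rewrite /encode numeralE /code /goods_code /=; congr (_ ++ _ :: flatten _).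
  by rewrite -[RHS]map_comp; apply: eq_map => g; apply: encode_good_code.
move=> l0 l1; rewrite !map_assign => pm0 so0 pm1 so1.
have ev g : numval (binary (u ord0 g)) = u ord0 g := numval_binary _.
have [s0 gr0 ok0] := greedy_ok_content ev pm0 so0.
have [s1 gr1 ok1] := greedy_ok_content ev pm1 so1.
rewrite /= (ok0 _ (first_bundle A)); last first.
  by apply/setP => g; rewrite !inE addbF; case: (ord2P (A g)) => ->.
rewrite (ok1 _ (~: first_bundle A)); last first.
  by apply/setP => g; rewrite !inE addbT negbK; case: (ord2P (A g)) => ->.
rewrite size_map size_enum_ord numval_binary.
by apply: iff_sym; apply: (optimal_reachable id_u _ _ gr0 gr1).
Qed.

Lemma code_restricted d : well_formed d -> exists2 I, restricted I & encode I = code d.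
Proof.
case: d => x l /and3P[/= cx ln cl].
pose m := size l; have hm : 0 < m by rewrite lt0n size_eq0.
(* A default for [nth] that is never reached, as all indices are below [m]. *)
pose g0 : good := (false, [::]).
pose u (i : 'I_2) (g : 'I_m) := numval (nth g0 l g).2.
pose A : allocation 2 m := [ffun g : 'I_m => if (nth g0 l g).1 then ord_max else ord0].
pose I0 := @OEInstance 2 m isT hm u A (numval x).
have eg (g : 'I_m) : @encode_good I0 g = good_code (nth g0 l g).
  rewrite encode_good_code //; congr good_code.
  rewrite ffunE /u binary_numval; last by apply: (allP cl); apply: mem_nth.
  by rewrite [in RHS](surjective_pairing (nth g0 l g)); case: (_.1).
exists I0; first by split.
rewrite /encode /code numeralE binary_numval //; congr (_ ++ _ :: flatten _).
rewrite (eq_map eg); apply: (@eq_from_nth _ [::]).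
  by rewrite size_map size_enum_ord size_map.
move=> j; rewrite size_map size_enum_ord => lt_j.
rewrite (nth_map (Ordinal hm)) ?size_enum_ord // (nth_map g0) //.
by rewrite nth_enum_ord.
Qed.

Lemma exec_decide w : exists e st,
  exec decide (map inl w :: nseq 10 [::]) (600 * (size w).+1 ^ 3) e st /\
  ((exists d l0 l1, let n := minn (numval d.1) (size d.2) in
     [/\ well_formed d, w = code d,
         perm_eq l0 (map (assign false) d.2) /\ sorted richer l0,
         perm_eq l1 (map (assign true) d.2) /\ sorted richer l1 &
         e = greedy_ok n l0 && greedy_ok n l1]) \/
   (forall d, ~ (well_formed d /\ w = code d)) /\ e = false).
Proof.
(* Two runs and, in between, the rewinding of the input. *)
have bound : 200 * (size w).+1 ^ 3 + (2 * size w + 1 + 200 * (size w).+1 ^ 3) <=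
    600 * (size w).+1 ^ 3 by rewrite !expnS expn0; move: (size w); nia.
have bound1 : 200 * (size w).+1 ^ 3 <= 600 * (size w).+1 ^ 3 by rewrite leq_mul2r orbT.
case: (exec_run_role false w) => [[d [l0 [e [st [wf ew pm0 ee [ex est]]]]]]|[no [st ex]]];
    last first.
  exists false, st; split; last by right.
  exact: exec_le bound1 (exec_seq_reject _ ex).
(* The second run is analysed even if the first one rejects, because it supplies the sorted list
   [l1]. *)
case: (exec_run_role true w) => [[d' [l1 [e' [st' [wf' ew' pm1 ee' [ex' _]]]]]]|[no _]];
    last by case: (no d).
have dd : d' = d by apply: code_inj; rewrite -ew -ew'.
rewrite dd in pm1 ee'.
case: e ee ex est => ee ex est; last first.
  exists false, st; split; first exact: exec_le bound1 (exec_seq_reject _ ex).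
  by left; exists d, l0, l1; split=> //; rewrite -ee.
rewrite est // in ex.
exists e', st'; split; last first.
  by left; exists d, l0, l1; split=> //; rewrite -ee /= -ee'.
apply: exec_eq.
- eapply exec_seq; first exact: ex.
  eapply exec_seq; first by apply: exec_drain.
  rewrite /= revK cats0; exact: ex'.
- by [].
- by rewrite /= size_rev size_map.
Qed.

Theorem theorem4p1 :
  in_P (optimal_exchanges_language
          (fun I : oe_instance => two_agents I /\ identical_utilities I)).
Proof.
pose p : {poly nat} := ((('X + 1) ^+ 3) * 600%:P)%R.
apply: (@in_P_exec _ _ 10 decide p) => w.
have -> : (p.[size w])%R = 600 * (size w).+1 ^ 3.
  by rewrite hornerM horner_exp hornerD hornerX !hornerC [LHS]mulnC [(_ + 1)%R]addn1.
have [e [st [ex dec]]] := exec_decide w; exists e, st; split=> //.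
case: dec => [[d [l0 [l1 [wf ew [pm0 so0] [pm1 so1] ->]]]]|[no ->]].
  split=> [ok|[I [/restricted_code[d' [wf' ed' eq]] opt ewI]]].
    have [I resI eI] := code_restricted wf.
    have [d' [wf' ed' eq]] := restricted_code resI.
    have dd : d' = d by apply: code_inj; rewrite -ed' eI.
    exists I; split=> //; last by rewrite eI.
    by rewrite dd in eq; apply/(eq l0 l1).
  (* Whichever instance is behind [w], its decoding is the one found by the parser, because [code]
     is injective. *)
  have dd : d' = d by apply: code_inj; rewrite -ed' -ewI ew.
  by rewrite dd in eq; apply/(eq l0 l1).
split=> // -[I [/restricted_code[d [wf ed _]] _ ew]].
by case: (no d); rewrite ew ed.
Qed.
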